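(* Let $(X,T)$ be a dynamical system which is $K$-closeable with respect to a linkable set $K\subset\mathrm{Per}(T)$. Then for every $\mu\in\mathcal M_T(X)$ the set of points generic for $\mu$ is dense in the measure center $C_M(T)$.
   Context: A dynamical system $(X,T)$ consists of a complete separable metric space $(X,\rho)$ and a continuous surjection $T\colon X\to X$. $\mathcal M_T(X)$ is the set of $T$-invariant Borel probability measures (weak$*$ topology). The measure center $C_M(T)$ is the complement of the union of all open sets $U$ with $\mu(U)=0$ for every $\mu\in\mathcal M_T(X)$. $\mathcal E(x,n)=\frac1n\sum_{j<n}\delta_{T^jx}$; $x$ is generic for $\mu$ if $\mathcal E(x,n)\to\mu$ weak$*$. $B(x,n,\varepsilon)=\{y:\rho(T^jy,T^jx)<\varepsilon,\ 0\le j<n\}$. A point $x$ is $K$-closeable if for every $\varepsilon>0$, $N>0$ there exist integers $N\le p\le q\le(1+\varepsilon)p$ and $y\in B(x,p,\varepsilon)\cap K$ with $T^qy=y$; $(X,T)$ is $K$-closeable if every ergodic measure has a $K$-closeable generic point. $K\subset\mathrm{Per}(T)$ is linkable if for all $y_1,y_2\in K$, $\varepsilon>0$, $\lambda\in[0,1]$ there exist $p_1,p_2,q_1,q_2\in\mathbb N$ and $z\in K$ with: $T^{q_2}z=z$; $\lambda-\varepsilon\le\frac{p_1}{p_1+p_2}\le\lambda+\varepsilon$; $p_1\le q_1\le(1+\varepsilon)p_1$ and $z\in B(y_1,p_1,\varepsilon)$; $p_2\le q_2-q_1\le(1+\varepsilon)p_2$ and $T^{q_1}z\in B(y_2,p_2,\varepsilon)$.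 *)

(* Defs.v *)
From HB Require Import structures.
From mathcomp Require Import all_boot all_order all_algebra.
From mathcomp Require Import all_classical all_reals all_analysis.
Set Implicit Arguments. Unset Strict Implicit. Unset Printing Implicit Defensive.
Import Order.TTheory GRing.Theory Num.Theory.
Local Open Scope classical_set_scope.
Local Open Scope ring_scope.

Section MetricDynamics.
Variables (R : realType) (X : pointedType) (rho : X -> X -> R).

Definition is_metric : Prop :=
  (forall x y, 0 <= rho x y) /\
  (forall x y, rho x y = 0 <-> x = y) /\
  (forall x y, rho x y = rho y x) /\
  (forall x y z, rho x z <= rho x y + rho y z).

Definition rho_open (U : set X) : Prop :=
  forall x, U x -> exists2 e : R, 0 < e & forall y, rho x y < e -> U y.

Definition rho_cauchy (u : nat -> X) : Prop :=
  forall e : R, 0 < e -> exists N, forall m n, (N <= m)%N -> (N <= n)%N -> rho (u m) (u n) < e.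

Definition rho_complete : Prop :=
  forall u : nat -> X, rho_cauchy u ->
    exists l : X, forall e : R, 0 < e -> exists N, forall n, (N <= n)%N -> rho (u n) l < e.

Definition rho_separable : Prop :=
  exists D : set X, countable D /\
    forall x (e : R), 0 < e -> exists2 y, D y & rho x y < e.

Definition rho_continuous (f : X -> X) : Prop :=
  forall x (e : R), 0 < e -> exists2 d : R, 0 < d & forall y, rho x y < d -> rho (f x) (f y) < e.

Definition rho_continuous_real (f : X -> R) : Prop :=
  forall x (e : R), 0 < e -> exists2 d : R, 0 < d & forall y, rho x y < d -> `|f x - f y| < e.

Definition Borel : measurableType (rho_open).-sigma := g_sigma_algebraType rho_open.

Variable T : X -> X.

Definition invariant_prob (mu : probability Borel R) : Prop :=
  forall A : set Borel, measurable A -> mu (T @^-1` A) = mu A.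

Definition ergodic (mu : probability Borel R) : Prop :=
  invariant_prob mu /\
  forall A : set Borel, measurable A -> T @^-1` A = A ->
    mu A = 0%E \/ mu A = 1%E.

Definition measure_center : set X :=
  ~` [set x | exists U : set X, [/\ rho_open U,
        (forall mu : probability Borel R, invariant_prob mu -> mu U = 0%E) & U x]].

(** x is generic for mu: E(x,n) -> mu weak-* (tested on bounded continuous functions) *)
Definition generic (mu : probability Borel R) (x : X) : Prop :=
  forall f : X -> R, rho_continuous_real f -> (exists M : R, forall y, `|f y| <= M) ->
    (fun n : nat => ((n%:R)^-1 * \sum_(j < n) f (iter j T x))%:E) @ \oo
      --> (\int[mu]_y (f y)%:E)%E.

Definition bowen_ball (x : X) (n : nat) (e : R) : set X :=
  [set y | forall j, (j < n)%N -> rho (iter j T y) (iter j T x) < e].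

Definition Per : set X := [set y | exists q, (0 < q)%N /\ iter q T y = y].

Definition K_closeable_point (K : set X) (x : X) : Prop :=
  forall (e : R) (N : nat), 0 < e -> (0 < N)%N ->
    exists p q : nat, [/\ (N <= p)%N, (p <= q)%N, q%:R <= (1 + e) * p%:R &
      exists y, [/\ bowen_ball x p e y, K y & iter q T y = y]].

Definition K_closeable (K : set X) : Prop :=
  forall mu : probability Borel R, ergodic mu ->
    exists x, generic mu x /\ K_closeable_point K x.

Definition linkable (K : set X) : Prop :=
  K `<=` Per /\
  forall y1 y2, K y1 -> K y2 -> forall (e lam : R), 0 < e -> 0 <= lam <= 1 ->
    exists p1 p2 q1 q2 : nat, (0 < p1)%N /\ (0 < p2)%N /\ (0 < q1)%N /\ (0 < q2)%N /\
      exists z, [/\ K z, iter q2 T z = z,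
        lam - e <= p1%:R / (p1 + p2)%:R <= lam + e,
        [/\ (p1 <= q1)%N, q1%:R <= (1 + e) * p1%:R & bowen_ball y1 p1 e z] &
        [/\ (p2 <= q2 - q1)%N, (q2 - q1)%:R <= (1 + e) * p2%:R &
            bowen_ball y2 p2 e (iter q1 T z)]].

End MetricDynamics.

Arguments Borel {R X} rho.
Arguments invariant_prob {R X} rho T mu.
Arguments ergodic {R X} rho T mu.
Arguments measure_center {R X} rho T _.
Arguments generic {R X} rho T mu x.
Arguments bowen_ball {R X} rho T x n e _.
Arguments Per {X} T _.
Arguments K_closeable_point {R X} rho T K x.
Arguments K_closeable {R X} rho T K.
Arguments linkable {R X} rho T K.

(* Main.v *)
Require Import Defs.
From HB Require Import structures.
From mathcomp Require Import all_boot all_order all_algebra.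
From mathcomp Require Import all_classical all_reals all_analysis.
From mathcomp Require Import measurable_realfun.
From mathcomp Require Import ring lra zify.
Import Order.TTheory GRing.Theory Num.Theory.
Import numFieldNormedType.Exports.
Set Implicit Arguments. Unset Strict Implicit. Unset Printing Implicit Defensive.
Local Open Scope classical_set_scope.
Local Open Scope ring_scope.

(** For a [mu]-typical point [x] the frequencies of visits of [x] to the sets of a countable
    algebra generating the Borel sets and stable under [T^-1] exist by Birkhoff's theorem;
    inner regularity of [mu] makes them countably additive, and the L^2 convergence of the
    averages makes the resulting invariant measure ergodic. Since the integral of [f] against
    this measure is the limit of the Birkhoff averages of [f] at [x], the ergodic measures
    [nu] satisfy [sup_nu int f dnu >= int f dmu] for every bounded measurable [f].

    Closeability transports the averages of a Lipschitz [f] from an ergodic measure to a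
    periodic orbit in [K], and linkability makes the set of vectors of averages of finitely
    many Lipschitz functions over such orbits convex up to closure. A convex set that meets,
    up to closure, every half-space whose boundary contains [m] is adherent to [m], hence
    every invariant [mu] is a weak limit of orbit measures carried by periodic points of [K].

    A generic point of [mu] near a point of the measure center is the limit of periodic
    points [w_k] of [K]: [w_0] visits the prescribed neighbourhood, and [w_(k+1)] links a long
    piece of the orbit of [w_k] to a much longer piece of a periodic orbit close to [mu]. *)

(** * Upper limits and integrals of bounded measurable functions *)

(** The space is not assumed compact, and this shapes the proof. Frequencies along one orbit may
    lose mass in the limit, so they are only finitely additive until tightness is read off from
    [mu]. Bounded continuous functions need not have a countable uniformly dense family, so
    genericity is tested on countably many Lipschitz functions that approximate from below.

    No ergodic decomposition is built. Separation by a hyperplane deals with one linear functional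
    at a time, so one ergodic measure per functional and tolerance is enough, and a single typical
    point provides it.

    In the last construction averages must be close to those of [mu] at all large times and not only
    at the ends of periods. Hence a new stage follows the old one until the boundary terms of both
    periods are negligible, and at later times its deviation is bounded by the worse of the two
    pieces. The new period is still dominated by the target orbit, because linkability allows an
    arbitrarily small proportion [lam] of time for the old stage. *)

Section UpperLimit.
Variable R : realType.
Implicit Types (u : nat -> R) (M l e : R).

Lemma bounded_funP u M : (forall n, `|u n| <= M) -> bounded_fun u.
Proof.
move=> uM; exists M; split; first exact: num_real.
by move=> x Mx n _ /=; apply: le_trans (uM n) (ltW Mx).
Qed.

Lemma limn_sup_lt u M l : (forall n, `|u n| <= M) -> limn_sup u < l ->
  exists N, forall n, (N <= n)%N -> u n < l.
Proof.
move=> uM; have bu := bounded_funP uM.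
rewrite limn_supE// => /inf_lt -/(_ (ex_intro _ _ (imageT _ 0%N)))[_ [N _ <-] lN].
exists N => n Nn; apply: le_lt_trans lN; apply: ub_le_sup; last by exists n.
exact/has_ubound_sdrop/bounded_fun_has_ubound.
Qed.

Lemma limn_sup_gt u M l N : (forall n, `|u n| <= M) -> l < limn_sup u ->
  exists2 n, (N <= n)%N & l < u n.
Proof.
move=> uM; have bu := bounded_funP uM.
rewrite limn_supE// => lu.
have : l < sups u N.
  apply: lt_le_trans lu _; apply: ge_inf; last by exists N.
  exact: bounded_fun_has_lbound_sups.
case/sup_gt => [|_ [n /= Nn <-] lun]; last by exists n.
by exists (u N); exists N => /=.
Qed.

Lemma limn_sup_le u M l N : (forall n, `|u n| <= M) ->
  (forall n, (N <= n)%N -> u n <= l) -> limn_sup u <= l.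
Proof.
move=> uM ul; rewrite leNgt; apply/negP => /(limn_sup_gt N uM)[n Nn].
by rewrite ltNge ul.
Qed.

Lemma limn_sup_ge u M l : (forall n, `|u n| <= M) ->
  (forall N, exists2 n, (N <= n)%N & l <= u n) -> l <= limn_sup u.
Proof.
move=> uM ul; rewrite leNgt; apply/negP => /(limn_sup_lt uM)[N uN].
by have [n /uN] := ul N; rewrite ltNge => /negP.
Qed.

Lemma limn_sup_bound u M : (forall n, `|u n| <= M) -> `|limn_sup u| <= M.
Proof.
move=> uM; rewrite ler_norml; apply/andP; split.
  apply: (limn_sup_ge uM) => N; exists N => //.
  by have := uM N; rewrite ler_norml => /andP[].
apply: (limn_sup_le (N := 0%N) uM) => n _.
by have := uM n; rewrite ler_norml => /andP[].
Qed.

Lemma limn_sup_le_trans u v M M' : (forall n, `|u n| <= M) -> (forall n, `|v n| <= M') ->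
  (forall e, 0 < e -> exists N, forall n, (N <= n)%N -> u n <= v n + e) ->
  limn_sup u <= limn_sup v.
Proof.
move=> uM vM uv; apply/ler_addgt0Pr => e e0.
have e20 : 0 < e / 2 by rewrite divr_gt0.
have [N uvN] := uv _ e20.
have /(limn_sup_lt vM)[N' vN'] : limn_sup v < limn_sup v + e / 2 by rewrite ltrDl.
apply: (limn_sup_le (N := maxn N N') uM) => n; rewrite geq_max => /andP[Nn N'n].
by have := uvN _ Nn; have := vN' _ N'n; lra.
Qed.

Lemma cvgnP (u : nat -> R) l : u @ \oo --> l <->
  (forall e, 0 < e -> exists N, forall n, (N <= n)%N -> `|u n - l| < e).
Proof.
split=> [ul e e0|ul].
  have /cvgrPdist_lt/(_ _ e0)[N _ Nu] := ul.
  by exists N => n Nn; rewrite distrC; exact: Nu.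
apply/cvgrPdist_lt => e /ul[N Nu]; exists N => // n /= Nn.
by rewrite distrC; exact: Nu.
Qed.

End UpperLimit.

Section BoundedMeasurable.
Context {d : measure_display} {X : measurableType d} {R : realType}.
Implicit Types f g : X -> R.

(** Such functions are integrable for every probability and stable under all operations used below,
    so the real-valued integral is linear and monotone on them without further conditions. *)
Definition bmeas g : Prop :=
  measurable_fun setT g /\ exists M, forall x, `|g x| <= M.

Lemma bmeas_cst (c : R) : bmeas (fun=> c).
Proof. by split; [exact: measurable_cst|exists `|c|]. Qed.

Lemma bmeasD f g : bmeas f -> bmeas g -> bmeas (fun x => f x + g x).
Proof.
move=> [mf [M fM]] [mg [N gN]]; split; first exact: measurable_funD.
by exists (M + N) => x; apply: le_trans (ler_normD _ _) (lerD (fM x) (gN x)).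
Qed.

Lemma bmeasM f g : bmeas f -> bmeas g -> bmeas (fun x => f x * g x).
Proof.
move=> [mf [M fM]] [mg [N gN]]; split; first exact: measurable_funM.
by exists (M * N) => x; rewrite normrM; apply: ler_pM.
Qed.

Lemma bmeasZ (c : R) f : bmeas f -> bmeas (fun x => c * f x).
Proof. exact/bmeasM/bmeas_cst. Qed.

Lemma bmeasN f : bmeas f -> bmeas (fun x => - f x).
Proof.
move=> /(bmeasZ (-1)); congr bmeas; apply/funext => x; by rewrite mulN1r.
Qed.

Lemma bmeasB f g : bmeas f -> bmeas g -> bmeas (fun x => f x - g x).
Proof. by move=> bf /bmeasN; exact: bmeasD. Qed.

Lemma bmeas_sum (J : Type) (r : seq J) (F : J -> X -> R) :
  (forall i, bmeas (F i)) -> bmeas (fun x => \sum_(i <- r) F i x).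
Proof.
move=> bF; elim: r => [|i r IH].
  have := bmeas_cst 0; congr bmeas; apply/funext => x; by rewrite big_nil.
have := bmeasD (bF i) IH; congr bmeas; apply/funext => x; by rewrite big_cons.
Qed.

Lemma bmeas_max f g : bmeas f -> bmeas g -> bmeas (fun x => Num.max (f x) (g x)).
Proof.
move=> [mf [M fM]] [mg [N gN]]; split; first exact: measurable_maxr.
exists (Num.max M N) => x; have [fg|gf] := leP (f x) (g x).
  by rewrite le_max gN orbT.
by rewrite le_max fM.
Qed.

Lemma bmeas_indic (A : set X) : measurable A -> bmeas (\1_A : X -> R).
Proof.
move=> mA; split; first exact: measurable_indic.
by exists 1 => x; rewrite indicE; case: (_ \in _); rewrite /= ?normr0 ?normr1.
Qed.

Lemma bmeas_comp (t : X -> X) g : measurable_fun setT t -> bmeas g ->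
  bmeas (fun x => g (t x)).
Proof.
by move=> mt [mg [M gM]]; split; [exact: (measurableT_comp mg)|exists M => x].
Qed.

Lemma bmeas_limn_sup (F : nat -> X -> R) (M : R) : (forall n, bmeas (F n)) ->
  (forall n x, `|F n x| <= M) -> bmeas (fun x => limn_sup (fun n => F n x)).
Proof.
move=> bF FM; split.
  apply: measurable_fun_limn_sup => [x _|x _|n]; last by case: (bF n).
    by exists M => _ [n _ <-]; have := FM n x; rewrite ler_norml => /andP[].
  by exists (- M) => _ [n _ <-]; have := FM n x; rewrite ler_norml => /andP[].
by exists M => x; apply: limn_sup_bound.
Qed.

Variable P : probability X R.

Lemma bmeas_integrable g : bmeas g -> P.-integrable setT (EFin \o g).
Proof.
move=> [mg [M gM]]; apply: measurable_bounded_integrable => //.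
  by rewrite -ge0_fin_numE ?fin_num_measure.
exists M; split; first exact: num_real.
by move=> x Mx y _ /=; apply: le_trans (gM y) (ltW Mx).
Qed.

Lemma EFin_Rintegral g : bmeas g ->
  (\int[P]_x (g x)%:E)%E = (\int[P]_x g x)%:E.
Proof. by move=> bg; rewrite /Rintegral fineK//; apply/integrable_fin_num/bmeas_integrable. Qed.

Lemma RintD f g : bmeas f -> bmeas g ->
  \int[P]_x (f x + g x) = \int[P]_x f x + \int[P]_x g x.
Proof. by move=> bf bg; apply: RintegralD => //; exact: bmeas_integrable. Qed.

Lemma RintB f g : bmeas f -> bmeas g ->
  \int[P]_x (f x - g x) = \int[P]_x f x - \int[P]_x g x.
Proof. by move=> bf bg; apply: RintegralB => //; exact: bmeas_integrable. Qed.

Lemma RintZ (c : R) f : bmeas f -> \int[P]_x (c * f x) = c * \int[P]_x f x.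
Proof. by move=> bf; apply: RintegralZl => //; exact: bmeas_integrable. Qed.

Lemma Rint_cst (c : R) : \int[P]_x c = c.
Proof.
rewrite Rintegral_cst// -[RHS]mulr1; congr (_ * _).
exact: (congr1 fine (probability_setT P)).
Qed.

Lemma Rint_sum (J : Type) (r : seq J) (F : J -> X -> R) : (forall i, bmeas (F i)) ->
  \int[P]_x (\sum_(i <- r) F i x) = \sum_(i <- r) \int[P]_x F i x.
Proof.
move=> bF; elim: r => [|i r IH].
  by under eq_Rintegral do rewrite big_nil; rewrite Rint_cst big_nil.
under eq_Rintegral do rewrite big_cons.
by rewrite RintD// ?IH ?big_cons//; exact: bmeas_sum.
Qed.

Lemma le_Rint f g : bmeas f -> bmeas g -> (forall x, f x <= g x) ->
  \int[P]_x f x <= \int[P]_x g x.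
Proof. by move=> bf bg fg; apply: le_Rintegral => //; exact: bmeas_integrable. Qed.

Lemma Rint_dist f g (c : R) : bmeas f -> bmeas g -> (forall x, `|f x - g x| <= c) ->
  `|\int[P]_x f x - \int[P]_x g x| <= c.
Proof.
move=> bf bg fg; have bfg := bmeasB bf bg.
rewrite -RintB// ler_norml; apply/andP; split.
  rewrite -[X in X <= _](Rint_cst (- c)); apply: le_Rint => //; first exact: bmeas_cst.
  by move=> x; have := fg x; rewrite ler_norml => /andP[].
rewrite -[X in _ <= X](Rint_cst c); apply: le_Rint => //; first exact: bmeas_cst.
by move=> x; have := fg x; rewrite ler_norml => /andP[].
Qed.

Lemma Rint_indic (A : set X) : measurable A -> \int[P]_x (\1_A x) = fine (P A).
Proof. by move=> mA; rewrite /Rintegral integral_indic// setIT. Qed.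

Lemma Rint_cvg_ae (F : nat -> X -> R) g (M : R) : (forall n, bmeas (F n)) ->
  (forall n x, `|F n x| <= M) -> bmeas g ->
  {ae P, forall x, (F n x) @[n --> \oo] --> g x} ->
  (\int[P]_x F n x) @[n --> \oo] --> \int[P]_x g x.
Proof.
move=> bF FM bg Fg.
have cF : {ae P, forall x, setT x -> (F n x)%:E @[n --> \oo] --> (g x)%:E}.
  apply: filterS Fg => x Fg _.
  by apply: cvg_EFin; [exact: nearW|exact: Fg].
have [_ _ h] := @dominated_convergence _ _ _ P setT measurableT
  (fun n => EFin \o F n) (EFin \o g) (EFin \o cst M)
  (fun n => proj2 (measurable_EFinP _ _) (proj1 (bF n)))
  (proj2 (measurable_EFinP _ _) (proj1 bg))
  cF (bmeas_integrable (bmeas_cst M))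
  (aeW P (fun x n _ => FM n x)).
apply: (fine_cvg (F := \oo)).
rewrite -EFin_Rintegral//; exact: h.
Qed.

Lemma Rint_cvg (F : nat -> X -> R) g (M : R) : (forall n, bmeas (F n)) ->
  (forall n x, `|F n x| <= M) -> bmeas g ->
  (forall x, (F n x) @[n --> \oo] --> g x) ->
  (\int[P]_x F n x) @[n --> \oo] --> \int[P]_x g x.
Proof. by move=> bF FM bg Fg; apply: Rint_cvg_ae FM _ _ => //; exact: aeW. Qed.

End BoundedMeasurable.
(** * Birkhoff's ergodic theorem *)

Section AlmostEverywhere.
Context {d : measure_display} {X : measurableType d} {R : realType}.
Variable P : probability X R.

(** Markov's inequality: the set where every [h n] is at least [c] has measure at most [e / c] for
    each [e]. This turns small integrals into information at single points without convergence of
    [h]. *)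
Lemma ae_small (h : nat -> X -> R) : (forall n, bmeas (h n)) ->
  (forall n x, 0 <= h n x) ->
  (forall e, 0 < e -> exists n, \int[P]_x h n x <= e) ->
  {ae P, forall x, forall e, 0 < e -> exists n, h n x < e}.
Proof.
move=> bh h0 hs.
(* Countably many thresholds suffice, so one null set serves all [e]. *)
suff H k : {ae P, forall x, exists n, h n x < k.+1%:R^-1}.
  have := ae_foralln H; apply: filterS => x Hx e e0.
  have [k _ ke] := near_infty_natSinv_lt (PosNum e0).
  by have [n hn] := Hx k; exists n; apply: lt_trans hn _; apply: (ke k) => /=.
set c := k.+1%:R^-1; have c0 : 0 < c by rewrite invr_gt0.
pose E := \bigcap_n (h n @^-1` `[c, +oo[).
have mE : measurable E.
  apply: bigcapT_measurable => n; rewrite -[X in measurable X]setTI.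
  by apply: (bh n).1 => //; exact: measurable_itv.
exists E; split=> //.
  have PE e : 0 < e -> c * fine (P E) <= e.
    move=> /hs[n]; apply: le_trans.
    rewrite -Rint_indic// -RintZ; last exact: bmeas_indic.
    apply: le_Rint => // [|x]; first exact/bmeasZ/bmeas_indic.
    rewrite indicE; have [/set_mem xE|_] := boolP (x \in E).
      by rewrite mulr1; have := xE n I; rewrite /= in_itv /= andbT.
    by rewrite mulr0.
  have fPE : fine (P E) <= 0.
    rewrite -(pmulr_rle0 _ c0); apply/ler_addgt0Pr => e; rewrite add0r; exact: PE.
  have PEf : P E \is a fin_num by exact: fin_num_measure.
  by apply/eqP; rewrite eq_le measure_ge0 andbT -(fineK PEf) lee_fin.
move=> x /= /forallNP nx n _ /=; rewrite in_itv /= andbT leNgt.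
exact/negP/nx.
Qed.

Lemma ae_eq0_Rint (h : X -> R) : bmeas h -> (forall x, 0 <= h x) ->
  \int[P]_x h x = 0 -> {ae P, forall x, h x = 0}.
Proof.
move=> bh h0 hi; have := @ae_small (fun=> h) (fun=> bh) (fun=> h0).
case=> [e e0|N [mN PN hN]]; first by exists 0%N; rewrite hi ltW.
exists N; split=> //; apply: subset_trans hN => x /= hx H; apply: hx.
apply/eqP; rewrite eq_le h0 andbT; apply/ler_addgt0Pr => e /H[_ /ltW]; by rewrite add0r.
Qed.

Lemma ae_exists_gt (Q : X -> Prop) (g : X -> R) c : {ae P, forall x, Q x} ->
  bmeas g -> c < \int[P]_x g x -> exists2 x, Q x & c < g x.
Proof.
move=> [N [mN PN QN]] bg; apply: contraPP => /forall2NP H.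
apply/negP; rewrite -leNgt.
have [_ [M gM]] := bg.
(* [M + |c|] lifts the bound above [g] on the null set [N], so that an inequality valid everywhere
   can be integrated. *)
have bN : bmeas (fun x => c + (M + `|c|) * \1_N x).
  by apply: bmeasD; [exact: bmeas_cst|exact/bmeasZ/bmeas_indic].
apply: (@le_trans _ _ (\int[P]_x (c + (M + `|c|) * \1_N x))).
  apply: le_Rint => // x; rewrite indicE; have [_|/negP xN] := boolP (x \in N).
    have := gM x; rewrite ler_norml mulr1 => /andP[_ h].
    by have := ler_norm (- c); rewrite normrN; lra.
  rewrite mulr0 addr0 leNgt; apply/negP => cg.
  have [nQ|//] := H x; apply: xN; rewrite inE; exact: QN.
rewrite RintD; [|exact: bmeas_cst|exact/bmeasZ/bmeas_indic].
rewrite Rint_cst RintZ; last exact: bmeas_indic.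
by rewrite Rint_indic// PN mulr0 addr0.
Qed.

End AlmostEverywhere.

Section Birkhoff.
Context {d : measure_display} {X : measurableType d} {R : realType}.
Variables (P : probability X R) (t : X -> X).
Hypothesis mt : measurable_fun setT t.
Hypothesis tP : forall A, measurable A -> P (t @^-1` A) = P A.
Implicit Types g h : X -> R.

Lemma Rint_comp g : bmeas g -> \int[P]_x g (t x) = \int[P]_x g x.
Proof.
move=> bg; congr fine.
have := @integral_pushforward _ _ X X R t mt P setT (EFin \o g)
  (proj2 (measurable_EFinP _ _) bg.1) _ measurableT.
rewrite preimage_setT => /(_ (bmeas_integrable P (bmeas_comp mt bg))) /= <-.
by apply: eq_measure_integral => A mA _; exact: tP.
Qed.

Definition bsum n g x : R := \sum_(j < n) g (iter j t x).
Definition bavg n g x : R := n%:R^-1 * bsum n g x.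
(** A limit superior is defined at every point and, for bounded [g], constant along every orbit. It
    replaces the conditional expectation on the invariant sets without an exceptional set. *)
Definition usup g x : R := limn_sup (fun n => bavg n g x).

Lemma bsumS n g x : bsum n.+1 g x = g x + bsum n g (t x).
Proof.
rewrite /bsum big_ord_recl; congr (_ + _).
by apply: eq_bigr => j _; rewrite -iterSr.
Qed.

Lemma bsumSr n g x : bsum n.+1 g x = bsum n g x + g (iter n t x).
Proof. by rewrite /bsum big_ord_recr. Qed.

Lemma bsum_bound n g x M : (forall y, `|g y| <= M) -> `|bsum n g x| <= n%:R * M.
Proof.
move=> gM; apply: le_trans (ler_norm_sum _ _ _) _.
apply: le_trans (ler_sum _ (fun i _ => gM _)) _.
by rewrite sumr_const card_ord mulr_natl.
Qed.

Lemma bavg_bound n g x M : (forall y, `|g y| <= M) -> `|bavg n g x| <= M.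
Proof.
move=> gM; rewrite normrM ger0_norm ?invr_ge0//.
(* The average over zero terms is 0 because [0^-1 = 0]. *)
case: n => [|n]; first by rewrite invr0 mul0r; exact: le_trans (gM x).
by rewrite ler_pdivrMl ?ltr0Sn//; exact: bsum_bound.
Qed.

Lemma measurable_iter j : measurable_fun setT (iter j t).
Proof.
elim: j => [|j IH]; first exact: measurable_id.
exact: (measurableT_comp mt).
Qed.

Lemma bmeas_bsum n g : bmeas g -> bmeas (bsum n g).
Proof.
move=> bg; apply: bmeas_sum => j; apply: bmeas_comp => //; exact: measurable_iter.
Qed.

Lemma bmeas_bavg n g : bmeas g -> bmeas (bavg n g).
Proof. by move=> bg; exact/bmeasZ/bmeas_bsum. Qed.

Lemma bmeas_usup g : bmeas g -> bmeas (usup g).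
Proof.
move=> bg; have [_ [M gM]] := bg.
by apply: (@bmeas_limn_sup _ _ _ (fun n => bavg n g) M) => *;
  [exact: bmeas_bavg|exact: bavg_bound].
Qed.

Lemma usup_bound g x M : (forall y, `|g y| <= M) -> `|usup g x| <= M.
Proof. by move=> gM; apply: limn_sup_bound => n; exact: bavg_bound. Qed.

Lemma Rint_iter g j : bmeas g -> \int[P]_x g (iter j t x) = \int[P]_x g x.
Proof.
move=> bg; elim: j => // j IH; rewrite -IH.
rewrite -(@Rint_comp (fun x => g (iter j t x))); last first.
  by apply: bmeas_comp => //; exact: measurable_iter.
by apply: eq_Rintegral => x _; rewrite iterSr.
Qed.

Lemma bavg_shift g x M : (forall y, `|g y| <= M) -> forall e : R, 0 < e ->
  exists N, forall n, (N <= n)%N -> `|bavg n g (t x) - bavg n g x| <= e.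
Proof.
move=> gM e e0; have M0 : 0 <= M by exact: le_trans (gM x).
have := archi_boundP (divr_ge0 (mulr_ge0 (ler0n R 2) M0) (ltW e0)).
set N := Num.bound _ => NE; exists N.+1 => -[//|n] Nn.
have -> : bavg n.+1 g (t x) - bavg n.+1 g x =
    n.+1%:R^-1 * (g (iter n.+1 t x) - g x).
  rewrite /bavg -mulrBr; congr (_ * _).
  by rewrite [bsum _ _ x]bsumS bsumSr -iterSr; ring.
rewrite normrM ger0_norm ?invr_ge0// ler_pdivrMl ?ltr0Sn//.
apply: le_trans (ler_normB _ _) _.
apply: (@le_trans _ _ (2 * M)); first by have := gM x; have := gM (iter n.+1 t x); lra.
rewrite -ler_pdivrMr//.
apply: le_trans (ltW NE) _; rewrite ler_nat; exact: leq_trans (leqnSn _) Nn.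
Qed.

Lemma usup_comp g x : bmeas g -> usup g (t x) = usup g x.
Proof.
move=> [_ [M gM]]; have bM y n := @bavg_bound n g y M gM.
apply/eqP; rewrite eq_le; apply/andP; split; apply: limn_sup_le_trans => // e e0.
  have [N NE] := bavg_shift x gM e0; exists N => n /NE.
  by rewrite ler_norml => /andP[_]; lra.
have [N NE] := bavg_shift x gM e0; exists N => n /NE.
by rewrite ler_norml => /andP[]; lra.
Qed.

Lemma usup_iter g x j : bmeas g -> usup g (iter j t x) = usup g x.
Proof. by move=> bg; elim: j => //= j IH; rewrite usup_comp. Qed.

(** The maximum of the sums [bsum n h x] over [n <= N], in the recursive form from which Garsia's
    inequality is read off. *)
Fixpoint garsia h N : X -> R :=
  if N is N'.+1 then fun x => Num.max 0 (h x + garsia h N' (t x)) else fun=> 0.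

Lemma garsia_ge0 h N x : 0 <= garsia h N x.
Proof. by case: N => //= N; rewrite le_max lexx. Qed.

Lemma bmeas_garsia h N : bmeas h -> bmeas (garsia h N).
Proof.
move=> bh; elim: N => [|N IH] /=; first exact: bmeas_cst.
apply: bmeas_max; first exact: bmeas_cst.
by apply: bmeasD => //; exact: bmeas_comp.
Qed.

Lemma garsia_le h N x : garsia h N x <= garsia h N.+1 x.
Proof.
elim: N x => [|N IH] x; first exact: garsia_ge0.
rewrite [X in X <= _]/= [X in _ <= X]/=.
by rewrite ge_max le_max lexx /= le_max lerD2l IH orbT.
Qed.

Lemma garsia_nd h x : nondecreasing_seq (fun N => garsia h N x).
Proof. by apply/nondecreasing_seqP => n; exact: garsia_le. Qed.

Lemma bsum_garsia h n x : bsum n h x <= garsia h n x.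
Proof.
elim: n x => [|n IH] x; first by rewrite /bsum big_ord0.
by rewrite bsumS /= le_max lerD2l IH orbT.
Qed.

(* Garsia's proof of the maximal ergodic theorem: [h >= h_N - h_N \o t] where [h_N > 0]. *)
Lemma maximal_ergodic h : bmeas h ->
  (forall x, exists n, 0 < bsum n h x) -> 0 <= \int[P]_x h x.
Proof.
move=> bh hp.
pose E N := [set x | 0 < garsia h N x].
have mE N : measurable (E N).
  rewrite [E N](_ : _ = setT `&` garsia h N @^-1` `]0, +oo[).
    by apply: (bmeas_garsia N bh).1 => //; exact: measurable_itv.
  by rewrite setTI; apply/seteqP; split=> x /=; rewrite /E/= in_itv /= andbT.
have bhE N : bmeas (fun x => h x * \1_(E N) x) by apply/bmeasM/bmeas_indic.
have ge0 N : 0 <= \int[P]_x (h x * \1_(E N) x).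
  have bN := bmeas_garsia N bh.
  have -> : 0 = \int[P]_x (garsia h N x - garsia h N (t x)).
    by rewrite RintB ?Rint_comp ?subrr//; exact: bmeas_comp.
  apply: le_Rint => // [|x]; first by apply/bmeasB => //; exact: bmeas_comp.
  rewrite indicE; have [/set_mem xE|/negP xE] := boolP (x \in E N).
    rewrite mulr1 lerBlDr; move: xE; rewrite /E /=; case: (N) => [/=|n]; first by rewrite ltxx.
    have le := garsia_le h n (t x); move: (garsia h n.+1 (t x)) le => a le.
    rewrite /= lt_max ltxx /= => hh.
    by rewrite ge_max; apply/andP; split; lra.
  rewrite mulr0 subr_le0; apply: le_trans (garsia_ge0 _ _ _).
  by rewrite leNgt; apply/negP => h1; apply: xE; rewrite inE.
have [mh [M hM]] := bh.
(* By [hp] each point lies in [E N] for all large [N], so the truncated integrals tend to that of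
   [h]. *)
have cv : (\int[P]_x (h x * \1_(E N) x)) @[N --> \oo] --> \int[P]_x h x.
  apply: (@Rint_cvg _ _ _ _ _ _ M) => // [N x|x].
    rewrite normrM indicE; case: (_ \in _); rewrite ?normr1 ?mulr1// normr0 mulr0.
    exact: le_trans (hM x).
  have [n hn] := hp x; apply/cvgnP => e e0; exists n => m nm.
  rewrite indicE mem_set ?mulr1 ?subrr ?normr0//=.
  rewrite /E /=; apply: lt_le_trans hn _.
  exact: le_trans (bsum_garsia _ _ _) (garsia_nd h x nm).
rewrite -(cvg_lim _ cv)//; apply: limr_ge; first by apply/cvg_ex; eexists; exact: cv.
exact: nearW.
Qed.

(** Since [usup g] is constant along orbits, [n] steps of [g - usup g + e] sum to [n] times
    [bavg n g - usup g + e]. This is positive for some [n >= 1], so the maximal inequality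
    applies. *)
Lemma usup_le_Rint g : bmeas g -> \int[P]_x usup g x <= \int[P]_x g x.
Proof.
move=> bg; apply/ler_addgt0Pr => e e0; have [_ [M gM]] := bg.
have bu := bmeas_usup bg.
pose h x := g x - usup g x + e.
have bh : bmeas h by apply: bmeasD; [exact: bmeasB|exact: bmeas_cst].
have : 0 <= \int[P]_x h x.
  apply: maximal_ergodic => // x.
  have [n n1 hn] : exists2 n, (1 <= n)%N & usup g x - e < bavg n g x.
    by apply: (@limn_sup_gt _ _ M) => [n|]; [exact: bavg_bound|rewrite -/(usup g x); lra].
  exists n.
  have -> : bsum n h x = n%:R * (bavg n g x - usup g x + e).
    rewrite /bsum /h.
    under eq_bigr => i _ do rewrite usup_iter// -addrA.
    rewrite big_split /= sumr_const card_ord -mulr_natl /bavg /bsum.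
    have n0 : n%:R != 0 :> R by rewrite pnatr_eq0 -lt0n.
    by field.
  rewrite mulr_gt0 ?ltr0n//; lra.
rewrite RintD; [|exact: bmeasB|exact: bmeas_cst].
by rewrite RintB// Rint_cst; lra.
Qed.

Lemma birkhoff g : bmeas g -> \int[P]_x usup g x = \int[P]_x g x /\
  {ae P, forall x, (bavg n g x) @[n --> \oo] --> usup g x}.
Proof.
move=> bg; have bNg := bmeasN bg; have [_ [M gM]] := bg.
have bu := bmeas_usup bg; have bu' := bmeas_usup bNg.
have NgM x : `|- g x| <= M by rewrite normrN.
have le1 := usup_le_Rint bg; have := usup_le_Rint bNg.
rewrite [X in _ <= X](_ : _ = - \int[P]_x g x); last first.
  rewrite -mulN1r -RintZ//; by apply: eq_Rintegral => x _; rewrite mulN1r.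
move=> le2.
have bN n x : bavg n (fun y => - g y) x = - bavg n g x.
  by rewrite /bavg /bsum sumrN mulrN.
(* [- usup (- g)] is the lower limit of the averages. The gap between the two limits is nonnegative,
   and the two inequalities force its integral to vanish. *)
have s0 x : 0 <= usup g x + usup (fun y => - g y) x.
  rewrite leNgt; apply/negP => s0.
  pose e := - (usup g x + usup (fun y => - g y) x) / 2.
  have [N1 H1] : exists N, forall n, (N <= n)%N -> bavg n g x < usup g x + e.
    by apply: (@limn_sup_lt _ _ M) => [n|]; [exact: bavg_bound|rewrite ltrDl /e; lra].
  have [N2 H2] : exists N, forall n, (N <= n)%N ->
      bavg n (fun y => - g y) x < usup (fun y => - g y) x + e.
    by apply: (@limn_sup_lt _ _ M) => [n|]; [exact: bavg_bound|rewrite ltrDl /e; lra].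
  have := H1 _ (leq_maxl N1 N2); have := H2 _ (leq_maxr N1 N2).
  by rewrite bN /e; lra.
have bs := bmeasD bu bu'.
have is0 : \int[P]_x (usup g x + usup (fun y => - g y) x) = 0.
  have := le_Rint P (bmeas_cst 0) bs s0.
  by rewrite Rint_cst RintD//; lra.
split; first by move: is0; rewrite RintD//; lra.
have := ae_eq0_Rint bs s0 is0; apply: filterS => x Hx.
apply/cvgnP => e e0.
have [N1 H1] : exists N, forall n, (N <= n)%N -> bavg n g x < usup g x + e.
  by apply: (@limn_sup_lt _ _ M) => [n|]; [exact: bavg_bound|rewrite ltrDl].
have [N2 H2] : exists N, forall n, (N <= n)%N ->
    bavg n (fun y => - g y) x < usup (fun y => - g y) x + e.
  by apply: (@limn_sup_lt _ _ M) => [n|]; [exact: bavg_bound|rewrite ltrDl].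
exists (maxn N1 N2) => n; rewrite geq_max => /andP[/H1 h1 /H2].
by rewrite bN ltr_norml => h2; apply/andP; split; lra.
Qed.

End Birkhoff.
(** * Inner regularity by compact sets *)

Section SmallSets.
Context {d : measure_display} {X : measurableType d} {R : realType}.
Variable P : probability X R.

Lemma prob_vanish (A : nat -> set X) : (forall n, measurable (A n)) ->
  (forall n, A n.+1 `<=` A n) -> \bigcap_n A n = set0 ->
  forall e : R, 0 < e -> exists n, (P (A n) <= e%:E)%E.
Proof.
move=> mA dA A0 e e0.
have dA' n k : A (k + n)%N `<=` A n.
  by elim: k => // k IH; apply: subset_trans IH; exact: dA.
have : (\int[P]_x \1_(A n) x) @[n --> \oo] --> \int[P]_x (0 : R).
  apply: (@Rint_cvg _ _ _ _ _ _ 1) => [n|n x||x].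
  - exact: bmeas_indic.
  - by rewrite indicE; case: (_ \in _); rewrite ?normr1 ?normr0.
  - exact: bmeas_cst.
  - have : ~ (\bigcap_n A n) x by rewrite A0.
    move=> /existsNP[n /not_implyP[_ nx]].
    apply/cvgnP => e' e'0; exists n => m nm.
    rewrite indicE memNset ?subrr ?normr0// => Am; apply: nx.
    by move: Am; rewrite -(subnK nm); exact: dA'.
rewrite Rint_cst => /cvgnP/(_ _ e0)[n /(_ n (leqnn n))].
rewrite Rint_indic// subr0 => /ltW h; exists n.
rewrite -(fineK (fin_num_measure P _ (mA n))) lee_fin.
exact: le_trans (ler_norm _) h.
Qed.

Lemma prob_bigcup_le (A : nat -> set X) (e : R) : 0 <= e ->
  (forall n, measurable (A n)) ->
  (forall n, (P (A n) <= (e / (2 ^ n.+1)%:R)%:E)%E) ->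
  (P (\bigcup_n A n) <= e%:E)%E.
Proof.
move=> e0 mA Ae.
apply: le_trans (measure_sigma_subadditive P mA _ (@subset_refl _ _)) _.
  exact: bigcup_measurable.
apply: le_trans (epsilon_trick0 xpredT e0).
by apply: lee_nneseries => // n _; exact: Ae.
Qed.

End SmallSets.

Section Metric.
Variables (R : realType) (X : pointedType) (rho : X -> X -> R).
Hypothesis rhoM : is_metric rho.

Lemma rho_ge0 x y : 0 <= rho x y. Proof. by case: rhoM. Qed.
Lemma rhoxx x : rho x x = 0. Proof. by case: rhoM => _ [+ _] => /(_ x x)[_ ->]. Qed.
Lemma rhoC x y : rho x y = rho y x. Proof. by case: rhoM => _ [_ [+ _]]. Qed.
Lemma rho_triangle x y z : rho x z <= rho x y + rho y z.
Proof. by case: rhoM => _ [_ [_]]. Qed.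

Definition rho_closed (F : set X) := rho_open rho (~` F).

Lemma rho_openT : rho_open rho setT.
Proof. by move=> x _; exists 1. Qed.

Lemma rho_open0 : rho_open rho set0.
Proof. by []. Qed.

Lemma rho_openI U V : rho_open rho U -> rho_open rho V -> rho_open rho (U `&` V).
Proof.
move=> oU oV x [/oU[e e0 eU] /oV[e' e'0 eV]].
exists (Num.min e e'); first by rewrite lt_min e0.
by move=> y; rewrite lt_min => /andP[/eU ? /eV].
Qed.

Lemma rho_openU U V : rho_open rho U -> rho_open rho V -> rho_open rho (U `|` V).
Proof.
by move=> oU oV x [/oU|/oV] [e e0 eU]; exists e => // y /eU; [left|right].
Qed.

Lemma rho_open_bigcup (U : nat -> set X) : (forall n, rho_open rho (U n)) ->
  rho_open rho (\bigcup_n U n).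
Proof. by move=> oU x [n _ /(oU n)[e e0 eU]]; exists e => // y /eU ?; exists n. Qed.

Lemma rho_closedI F G : rho_closed F -> rho_closed G -> rho_closed (F `&` G).
Proof. by rewrite /rho_closed setCI; exact: rho_openU. Qed.

Lemma rho_closed_bigcap (F : nat -> set X) : (forall n, rho_closed (F n)) ->
  rho_closed (\bigcap_n F n).
Proof. by rewrite /rho_closed setC_bigcap => cF; exact: rho_open_bigcup. Qed.

Lemma rho_closed_bigsetU (F : nat -> set X) n : (forall n, rho_closed (F n)) ->
  rho_closed (\bigcup_(i < n) F i).
Proof.
move=> cF; elim: n => [|n IH]; first by rewrite bigcup_mkord big_ord0 /rho_closed setC0; exact: rho_openT.
rewrite bigcup_mkord big_ord_recr /= -bigcup_mkord /rho_closed setCU.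
by apply: rho_openI; [exact: IH|exact: cF].
Qed.

Lemma rho_closed_cball x r : rho_closed [set y | rho x y <= r].
Proof.
move=> y /= /negP; rewrite -ltNge => ry; exists (rho x y - r); first by lra.
move=> z yz; apply/negP; rewrite -ltNge.
by have := rho_triangle x z y; rewrite (rhoC z y); lra.
Qed.

Lemma rho_open_ball x r : rho_open rho [set y | rho x y < r].
Proof.
move=> y /= ry; exists (r - rho x y); first by lra.
by move=> z yz; have := rho_triangle x y z; lra.
Qed.

Lemma measurable_open (U : set X) : rho_open rho U -> measurable (U : set (Borel rho)).
Proof. exact: sub_sigma_algebra. Qed.

Lemma measurable_closed (F : set X) : rho_closed F -> measurable (F : set (Borel rho)).
Proof. by move=> cF; rewrite -[F]setCK; apply: measurableC; exact: measurable_open. Qed.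

(** Compactness in the only form that the tightness argument needs, stated without a topology on
    [X]. *)
Definition chain_compact (C : set X) := forall F : nat -> set X,
  (forall n, rho_closed (F n)) -> (forall n, F n.+1 `<=` F n) -> F 0%N `<=` C ->
  (forall n, F n !=set0) -> \bigcap_n F n !=set0.

Lemma chain_compact_sub C C' : C' `<=` C -> chain_compact C -> chain_compact C'.
Proof. by move=> CC' cC F cF dF FC; apply: cC => //; exact: subset_trans CC'. Qed.

Lemma decr_subset (F : nat -> set X) : (forall n, F n.+1 `<=` F n) ->
  forall m n, (m <= n)%N -> F n `<=` F m.
Proof.
move=> dF m n /subnK <-; elim: (n - m)%N => // k IH.
by apply: subset_trans IH; exact: dF.
Qed.

Hypothesis rhoX : rho_complete rho.

(** Among finitely many balls that cover [C], one meets every [F k] inside the current set.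
    Iterating gives nested sets [B n] of diameter tending to 0, and points chosen in both [B n] and
    [F n] form a Cauchy sequence. *)
Lemma totally_bounded_chain_compact (D : nat -> X) (N : nat -> nat) C :
  (forall m x, C x -> exists2 i, (i < N m)%N & rho (D i) x <= m.+1%:R^-1) ->
  chain_compact C.
Proof.
move=> tb F cF dF FC F0.
have dF' := decr_subset dF.
pose good (B : set X) := forall k, (B `&` F k) !=set0.
have step (mB : nat * set X) : exists B' : set X, good mB.2 ->
    [/\ B' `<=` mB.2, good B' & forall x y, B' x -> B' y -> rho x y <= 2 / mB.1.+1%:R].
  case: mB => m B /=; have [gB|ngB] := pselect (good B); last by exists setT.
  have [[i gi]|/forallNP ng] := pselect (exists i, good (B `&` [set x | rho (D i) x <= m.+1%:R^-1])).
    exists (B `&` [set x | rho (D i) x <= m.+1%:R^-1]) => _; split=> //.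
    move=> x y [_ /= xi] [_ /= yi]; have := rho_triangle x (D i) y.
    rewrite (rhoC x (D i)); move: (_ ^-1) xi yi => r; lra.
  have ng' i : exists k, ~ ((B `&` [set x | rho (D i) x <= m.+1%:R^-1]) `&` F k !=set0).
    exact/existsNP/ng.
  have [k hk] := choice ng'.
  (* If each ball misses some [F (k i)] inside [B], all of them miss [F] at the largest index,
     because [F] decreases. But a point of [B] in that set lies in one of the balls. *)
  have [x [Bx Fx]] := gB (\max_(i < N m) k i).
  have [i iN rx] := tb m x (FC _ (dF' _ _ (leq0n _) _ Fx)).
  exfalso; apply: (hk i); exists x; split=> //.
  exact: dF' (leq_bigmax (F := fun i : 'I_(N m) => k i) (Ordinal iN)) _ Fx.
have [s sP] := choice step.
pose B := fix B n := if n is n'.+1 then s (n', B n') else setT.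
have gB n : good (B n).
  elim: n => [|n IH]; first by move=> k; rewrite setTI.
  by have [] := sP (n, B n) IH.
have dB n : B n.+1 `<=` B n by have [] := sP (n, B n) (gB n).
have bB n x y : B n.+1 x -> B n.+1 y -> rho x y <= 2 / n.+1%:R.
  by have [_ _] := sP (n, B n) (gB n); exact.
have dB' := decr_subset dB.
have [u uP] := choice (fun n => gB n n).
have [l lP] : exists l : X, forall e : R, 0 < e ->
    exists N, forall n, (N <= n)%N -> rho (u n) l < e.
  apply: rhoX => e e0; have e20 : 0 < e / 2 by rewrite divr_gt0.
  have [k _ ke] := near_infty_natSinv_lt (PosNum e20).
  exists k.+1 => m n km kn.
  have := bB k (u m) (u n) (dB' _ _ km _ (uP m).1) (dB' _ _ kn _ (uP n).1).
  have := ke k (leqnn k); rewrite /=; move: (_ ^-1) => r; lra.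
exists l => k _; apply: contrapT => /(cF k)[e e0 he].
have [N0 hN] := lP _ e0.
have := hN _ (leq_maxl N0 k); rewrite rhoC => /he; apply.
exact: dF' (leq_maxr N0 k) _ (uP _).2.
Qed.

Lemma closed_thickening (U : set X) (r : R) :
  rho_closed [set x | forall y, rho x y < r -> U y].
Proof.
move=> x /= /existsNP[y /not_implyP[xy nU]].
exists (r - rho x y); first by lra.
move=> z xz; apply/existsNP; exists y; apply/not_implyP; split=> //.
by have := rho_triangle z x y; rewrite (rhoC z x); lra.
Qed.

Variable P : probability (Borel rho) R.

(** Approximation from both sides makes the class stable under complement, hence a sigma-algebra. *)
Definition squeezed (A : set X) := forall e : R, 0 < e -> exists F U : set X,
  [/\ rho_closed F, rho_open rho U, F `<=` A, A `<=` U & (P (U `\` F) <= e%:E)%E].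

Lemma squeezed_open (U : set X) : rho_open rho U -> squeezed U.
Proof.
move=> oU e e0; pose F n := [set x | forall y, rho x y < n.+1%:R^-1 -> U y].
have cF n : rho_closed (F n) by exact: closed_thickening.
have [|||n hn] := @prob_vanish _ _ _ P (fun n => U `\` F n) _ _ _ e e0.
- by move=> n; apply: measurableD; [exact: measurable_open|exact: measurable_closed].
- move=> n x [Ux nF]; split=> // Fx; apply: nF => y xy; apply: Fx.
  by apply: lt_le_trans xy _; rewrite lef_pV2 ?posrE// ler_nat.
- rewrite -subset0 => x Fx; have [Ux _] := Fx 0%N I.
  have [r r0 rU] := oU x Ux; have [k _ ke] := near_infty_natSinv_lt (PosNum r0).
  have [_ []] := Fx k I => y xy; apply: rU; apply: lt_trans xy _.
  exact: (ke k (leqnn k)).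
exists (F n), U; split=> // x; apply; rewrite rhoxx; by rewrite invr_gt0.
Qed.

Lemma squeezedC A : squeezed A -> squeezed (~` A).
Proof.
move=> sA e /sA[F [U [cF oU FA AU PUF]]]; exists (~` U), (~` F); split.
- by rewrite /rho_closed setCK.
- exact: cF.
- exact: subsetC.
- exact: subsetC.
- by rewrite setDE setCK setIC -setDE.
Qed.

(** The union of all [F n] need not be closed, so it is cut to a finite union. Half of [e] pays for
    the cut, the other half is shared geometrically by the differences of [U n] and [F n]. *)
Lemma squeezed_bigcup (A : nat -> set X) : (forall n, squeezed (A n)) ->
  squeezed (\bigcup_n A n).
Proof.
move=> sA e e0; have e20 : 0 < e / 2 by rewrite divr_gt0.
have h n : exists FU : set X * set X, [/\ rho_closed FU.1, rho_open rho FU.2,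
    FU.1 `<=` A n, A n `<=` FU.2 & (P (FU.2 `\` FU.1) <= ((e / 2) / (2 ^ n.+1)%:R)%:E)%E].
  have := sA n ((e / 2) / (2 ^ n.+1)%:R); case; first by rewrite divr_gt0// ltr0n expn_gt0.
  by move=> F [U H]; exists (F, U).
have [f fP] := choice h.
pose F n := (f n).1; pose U n := (f n).2.
have cF n : rho_closed (F n) by case: (fP n).
have oU n : rho_open rho (U n) by case: (fP n).
have mF n : measurable (F n : set (Borel rho)) by exact: measurable_closed.
have mU n : measurable (U n : set (Borel rho)) by exact: measurable_open.
have mG n : measurable (\bigcup_(i < n) F i : set (Borel rho)).
  by apply: measurable_closed; exact: rho_closed_bigsetU.
have mFF : measurable (\bigcup_i F i : set (Borel rho)) by exact: bigcup_measurable.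
have [|||n hn] := @prob_vanish _ _ _ P (fun n => (\bigcup_i F i) `\` \bigcup_(i < n) F i) _ _ _ _ e20.
- by move=> n; exact: measurableD.
- move=> n x [Fx nx]; split=> // -[i /= ni Fi]; apply: nx; exists i => //=.
  exact: leq_trans ni (leqnSn _).
- rewrite -subset0 => x Fx; have [[i _ Fi] _] := Fx 0%N I.
  by have [_] := Fx i.+1 I; apply; exists i => /=.
exists (\bigcup_(i < n) F i), (\bigcup_i U i); split.
- exact: rho_closed_bigsetU.
- exact: rho_open_bigcup.
- by move=> x [i _ Fi]; exists i => //; have [_ _ + _ _] := fP i; exact.
- by move=> x [i _ Ai]; exists i => //; have [_ _ _ + _] := fP i; exact.
have sub : \bigcup_i U i `\` \bigcup_(i < n) F i `<=`
    (\bigcup_i (U i `\` F i)) `|` ((\bigcup_i F i) `\` \bigcup_(i < n) F i).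
  move=> x [[i _ Ui] nx]; have [Fi|nFi] := pselect (F i x).
    by right; split=> //; exists i.
  by left; exists i.
have mUF : measurable (\bigcup_i (U i `\` F i) : set (Borel rho)).
  by apply: bigcup_measurable => i _; exact: measurableD.
apply: le_trans (le_measure P _ _ sub) _; rewrite ?inE.
- by apply: measurableD => //; exact: bigcup_measurable.
- by apply: measurableU => //; exact: measurableD.
apply: le_trans (measureU2 _ _ _) _ => //; first exact: measurableD.
rewrite (_ : e = e / 2 + e / 2); last by lra.
rewrite EFinD; apply: leeD => //; apply: prob_bigcup_le; first exact: ltW.
  by move=> i; exact: measurableD.
by move=> i; case: (fP i).
Qed.

Lemma squeezed_measurable (A : set (Borel rho)) : measurable A -> squeezed A.
Proof.
apply: (@smallest_sub _ _ _ squeezed); last exact: squeezed_open.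
split; first exact/squeezed_open/rho_open0.
- by move=> B /squeezedC; rewrite setTD.
- exact: squeezed_bigcup.
Qed.

Hypothesis rhoS : rho_separable rho.

Lemma dense_sequence : exists D : nat -> X, forall x (e : R), 0 < e ->
  exists i, rho (D i) x < e.
Proof.
have [D [cD dD]] := rhoS.
have [y0 Dy0 _] := dD point 1 ltr01.
have [g gP] : exists g : nat -> X, forall y, D y -> exists n, g n = y.
  have /pfcard_geP[D0|[g]] := cD.
    by exfalso; move: Dy0; rewrite D0.
  by exists g => y Dy; have [n _ <-] := 'surj_g Dy; exists n.
exists g => x e /(dD x)[y /gP[n <-]]; by rewrite rhoC; exists n.
Qed.

(** Ulam's argument: for each radius finitely many closed balls carry all but [e / 2^(m+1)] of the
    mass, and the intersection over all radii is closed and totally bounded. *)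
Lemma prob_tight (e : R) : 0 < e -> exists C : set X,
  [/\ rho_closed C, chain_compact C & (P (~` C) <= e%:E)%E].
Proof.
move=> e0; have [D dD] := dense_sequence.
pose B m i := [set x | rho (D i) x <= m.+1%:R^-1].
have cB m n : rho_closed (\bigcup_(i < n) B m i).
  by apply: rho_closed_bigsetU => i; exact: rho_closed_cball.
have h m : exists n, (P (~` \bigcup_(i < n) B m i) <= (e / (2 ^ m.+1)%:R)%:E)%E.
  apply: (@prob_vanish _ _ _ P (fun n => ~` \bigcup_(i < n) B m i)).
  - by move=> n; apply: measurableC; exact: measurable_closed.
  - move=> n; apply: subsetC => x [i /= ni Bi]; exists i => //=.
    exact: leq_trans ni (leqnSn _).
  - rewrite -subset0 => x nx; have [|i xi] := dD x m.+1%:R^-1; first by rewrite invr_gt0.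
    by apply: (nx i.+1 I); exists i => //=; exact: ltW.
  - by rewrite divr_gt0// ltr0n expn_gt0.
have [N hN] := choice h.
exists (\bigcap_m \bigcup_(i < N m) B m i); split.
- by apply: rho_closed_bigcap => m.
- apply: (@totally_bounded_chain_compact D N) => m x Cx.
  by have [i /= iN Bi] := Cx m I; exists i.
- rewrite setC_bigcap; apply: prob_bigcup_le; [exact: ltW| |exact: hN].
  by move=> m; apply: measurableC; exact: measurable_closed.
Qed.

Lemma inner_regular (A : set (Borel rho)) (e : R) : measurable A -> 0 < e ->
  exists C : set X, [/\ rho_closed C, chain_compact C, C `<=` A & (P (A `\` C) <= e%:E)%E].
Proof.
move=> mA e0; have e20 : 0 < e / 2 by rewrite divr_gt0.
have [F [U [cF oU FA AU PUF]]] := squeezed_measurable mA e20.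
have [C [cC kC PC]] := prob_tight e20.
have mF := measurable_closed cF; have mC := measurable_closed cC.
have mU := measurable_open oU.
exists (F `&` C); split.
- exact: rho_closedI.
- by apply: chain_compact_sub kC => x [].
- by move=> x [/FA].
have sub : A `\` (F `&` C) `<=` (U `\` F) `|` ~` C.
  move=> x [Ax nFC]; have [Fx|nF] := pselect (F x).
    by right => Cx; exact: nFC.
  by left; split=> //; exact: AU.
apply: le_trans (le_measure P _ _ sub) _; rewrite ?inE.
- by apply: measurableD => //; exact: measurableI.
- by apply: measurableU; [exact: measurableD|exact: measurableC].
apply: le_trans (measureU2 _ _ _) _ => //; [exact: measurableD|exact: measurableC|].
rewrite (_ : e = e / 2 + e / 2); last by lra.
by rewrite EFinD; exact: leeD.
Qed.

End Metric.
(** * Typical points and ergodic components *)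

(** Names for the sets of the smallest algebra that contains the atoms and is stable under preimage
    by [T]. The encoding into trees makes them countable, so that almost sure properties of single
    terms hold for all terms at once. *)
Inductive set_term := Atom of nat | Neg of set_term | And of set_term & set_term
  | Pre of set_term.

Fixpoint set_term_encode (s : set_term) : GenTree.tree nat :=
  match s with
  | Atom n => GenTree.Leaf n
  | Neg s => GenTree.Node 0 [:: set_term_encode s]
  | And s1 s2 => GenTree.Node 1 [:: set_term_encode s1; set_term_encode s2]
  | Pre s => GenTree.Node 2 [:: set_term_encode s]
  end.

Fixpoint set_term_decode (u : GenTree.tree nat) : set_term :=
  match u with
  | GenTree.Leaf n => Atom n
  | GenTree.Node 0 [:: s] => Neg (set_term_decode s)
  | GenTree.Node 1 [:: s1; s2] => And (set_term_decode s1) (set_term_decode s2)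
  | GenTree.Node 2 [:: s] => Pre (set_term_decode s)
  | _ => Atom 0
  end.

Lemma set_term_encodeK : cancel set_term_encode set_term_decode.
Proof. by elim=> //= [s ->|s1 -> s2 ->|s ->]. Qed.

Lemma ae_set_term {d : measure_display} {X : measurableType d} {R : realType}
    (P : probability X R) (Q : set_term -> X -> Prop) :
  (forall s, {ae P, forall x, Q s x}) -> {ae P, forall x, forall s, Q s x}.
Proof.
move=> aeQ; pose e n := if unpickle n is Some u then set_term_decode u else Atom 0.
have := @ae_foralln _ _ _ P (fun n => Q (e n)) (fun n => aeQ (e n)).
apply: filterS => x Qx s; have := Qx (pickle (set_term_encode s)).
by rewrite /e pickleK set_term_encodeK.
Qed.

Section UpperAverage.
Context {d : measure_display} {X : measurableType d} {R : realType}.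
Variable t : X -> X.
Implicit Types f g : X -> R.

Lemma eq_bavg f g : f =1 g -> forall n x, bavg t n f x = bavg t n g x.
Proof. by move=> fg n x; rewrite /bavg /bsum; congr (_ * _); apply: eq_bigr => j _. Qed.

Lemma bavgD n f g x : bavg t n (fun y => f y + g y) x = bavg t n f x + bavg t n g x.
Proof. by rewrite /bavg /bsum big_split mulrDr. Qed.

Lemma bavgZ n (c : R) f x : bavg t n (fun y => c * f y) x = c * bavg t n f x.
Proof. by rewrite /bavg /bsum -mulr_sumr mulrCA. Qed.

Lemma bavg_cst n (c : R) x : bavg t n.+1 (fun=> c) x = c.
Proof.
by rewrite /bavg /bsum sumr_const card_ord -[c *+ _]mulr_natl mulrA mulVf ?mul1r//.
Qed.

Lemma le_bavg n f g x : (forall y, f y <= g y) -> bavg t n f x <= bavg t n g x.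
Proof.
by move=> fg; rewrite /bavg ler_wpM2l ?invr_ge0//; apply: ler_sum => j _; exact: fg.
Qed.

Lemma le_usup f g x : bmeas f -> bmeas g -> (forall y, f y <= g y) ->
  usup t f x <= usup t g x.
Proof.
move=> [_ [M fM]] [_ [N gN]] fg.
apply: (@limn_sup_le_trans _ _ _ M N) => [n|n|e e0].
- exact: bavg_bound.
- exact: bavg_bound.
- by exists 0%N => n _; have := le_bavg n x fg; lra.
Qed.

Lemma usup_ge0 f x : bmeas f -> (forall y, 0 <= f y) -> 0 <= usup t f x.
Proof.
move=> bf f0; have [_ [M fM]] := bf.
apply: (@limn_sup_ge _ _ M) => [n|N]; first exact: bavg_bound.
by exists N => //; rewrite mulr_ge0 ?invr_ge0//; apply: sumr_ge0 => j _.
Qed.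

Lemma usupD_le f g x : bmeas f -> bmeas g ->
  usup t (fun y => f y + g y) x <= usup t f x + usup t g x.
Proof.
move=> bf bg; have bfg := bmeasD bf bg.
have [_ [M fM]] := bf; have [_ [N gN]] := bg; have [_ [K fgK]] := bfg.
apply/ler_addgt0Pr => e e0; have e20 : 0 < e / 2 by rewrite divr_gt0.
have [N1 H1] : exists N, forall n, (N <= n)%N -> bavg t n f x < usup t f x + e / 2.
  by apply: (@limn_sup_lt _ _ M) => [n|]; [exact: bavg_bound|rewrite ltrDl].
have [N2 H2] : exists N, forall n, (N <= n)%N -> bavg t n g x < usup t g x + e / 2.
  by apply: (@limn_sup_lt _ _ N) => [n|]; [exact: bavg_bound|rewrite ltrDl].
apply: (@limn_sup_le _ _ K _ (maxn N1 N2)) => [n|n]; first exact: bavg_bound.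
by rewrite geq_max bavgD => /andP[/H1 h1 /H2 h2]; lra.
Qed.

Lemma usup_cvg f x (l : R) : (bavg t n f x) @[n --> \oo] --> l -> usup t f x = l.
Proof. by move=> /cvg_limn_inf_sup[_]. Qed.

Lemma usup_bigcup (D : nat -> set X) n x : (forall i, measurable (D i)) ->
  usup t (\1_(\bigcup_(i < n) D i) : X -> R) x <= \sum_(i < n) usup t (\1_(D i)) x.
Proof.
move=> mD; have mU k : measurable (\bigcup_(i < k) D i) by exact: bigcup_measurable.
elim: n => [|n IH].
  rewrite big_ord0 bigcup_mkord big_ord0.
  rewrite (@usup_cvg _ _ 0)//; apply/cvgnP => e e0; exists 0%N => n _.
  by rewrite /bavg /bsum big1 ?mulr0 ?subrr ?normr0// => i _; rewrite indic0.
rewrite big_ord_recr /=; apply: le_trans (lerD IH (lexx _)).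
apply: le_trans (usupD_le _ (bmeas_indic (mU n)) (bmeas_indic (mD n))).
apply: le_usup; [exact: bmeas_indic|by apply: bmeasD; exact: bmeas_indic|].
move=> y; rewrite !indicE bigcup_mkord big_ord_recr /= -bigcup_mkord in_setU.
by case: (_ \in _); case: (_ \in _); rewrite /= ?addr0 ?add0r// lerDl.
Qed.

End UpperAverage.

Section GoodPoints.
Variables (R : realType) (X : pointedType) (rho : X -> X -> R) (T : X -> X).
Hypotheses (rhoM : is_metric rho) (rhoX : rho_complete rho) (rhoS : rho_separable rho).
Hypothesis cT : rho_continuous rho T.
Variable b : nat -> set X.
Hypothesis mb : forall n, measurable (b n : set (Borel rho)).

Notation avg := (@bavg _ (Borel rho) R T).
Notation uavg := (@usup _ (Borel rho) R T).

Lemma measurable_T : measurable_fun setT (T : Borel rho -> Borel rho).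
Proof.
apply: (@measurability _ _ (Borel rho) (Borel rho) _ _ (rho_open rho)) => //.
move=> _ [U oU <-]; apply: sub_sigma_algebra; rewrite setTI.
move=> x /= /oU[e e0 eU]; have [d d0 dT] := cT x e0.
by exists d => // y /dT /eU.
Qed.

Fixpoint ev (s : set_term) : set X :=
  match s with
  | Atom n => b n
  | Neg s => ~` ev s
  | And s1 s2 => ev s1 `&` ev s2
  | Pre s => T @^-1` ev s
  end.

Lemma measurable_ev s : measurable (ev s : set (Borel rho)).
Proof.
elim: s => [n|s IH|s1 IH1 s2 IH2|s IH] /=; first exact: mb.
- exact: measurableC.
- exact: measurableI.
- by rewrite -[X in measurable X]setTI; exact: measurable_T.
Qed.

(** Each clause serves one property of the measure built at [x]: existence of frequencies gives
    finite additivity, tightness gives countable additivity, and small mean square deviation along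
    the orbit gives ergodicity. *)
Definition good_point x :=
  [/\ forall s, (avg n (\1_(ev s)) x) @[n --> \oo] --> uavg (\1_(ev s)) x,
      forall s e, 0 < e -> exists C : set X, [/\ rho_closed rho C,
        chain_compact rho C, C `<=` ev s & uavg (\1_(ev s `\` C)) x < e] &
      forall s e, 0 < e -> exists n,
        uavg (fun y => (avg n.+1 (\1_(ev s)) y - uavg (\1_(ev s)) y) ^+ 2) x < e].

Variable mu : probability (Borel rho) R.
Hypothesis muT : invariant_prob rho T mu.

Let mT := measurable_T.

(** The last two clauses ask for small upper averages of nonnegative functions. By Birkhoff's
    theorem these have the same integrals as the functions, which are small by inner regularity or
    by dominated convergence, and [ae_small] applies. *)
Lemma ae_good_point : {ae mu, forall x, good_point x}.
Proof.
suff : [/\ {ae mu, forall x s, (avg n (\1_(ev s)) x) @[n --> \oo] --> uavg (\1_(ev s)) x},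
      {ae mu, forall x s e, 0 < e -> exists C : set X, [/\ rho_closed rho C,
        chain_compact rho C, C `<=` ev s & uavg (\1_(ev s `\` C)) x < e]} &
      {ae mu, forall x s e, 0 < e -> exists n,
        uavg (fun y => (avg n.+1 (\1_(ev s)) y - uavg (\1_(ev s)) y) ^+ 2) x < e}].
  by case=> h1 h2 h3; near=> x; split; near: x.
split; apply: ae_set_term => s; have mE := measurable_ev s; have bE := bmeas_indic (R := R) mE.
- by have [] := birkhoff mT muT bE.
- have h m : exists C : set X, [/\ rho_closed rho C,
      chain_compact rho C, C `<=` ev s & (mu (ev s `\` C) <= (m.+1%:R^-1)%:E)%E].
    by apply: inner_regular => //; rewrite invr_gt0.
  have [C CP] := choice h.
  have mD m : measurable (ev s `\` C m : set (Borel rho)).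
    by apply: measurableD => //; apply: measurable_closed; case: (CP m).
  have := @ae_small _ _ _ mu (fun m => uavg (\1_(ev s `\` C m))) _ _ _.
  case=> [m|m x|e e0|N [mN PN hN]].
  + exact/bmeas_usup/bmeas_indic.
  + by apply: usup_ge0; [exact: bmeas_indic|move=> y; rewrite indicE].
  + have [m _ me] := near_infty_natSinv_lt (PosNum e0); exists m.
    have [-> _] := birkhoff mT muT (bmeas_indic (mD m)).
    rewrite Rint_indic// -lee_fin fineK; last exact: fin_num_measure.
    have [_ _ _ /le_trans] := CP m; apply; rewrite lee_fin ltW//.
    exact: (me m (leqnn m)).
  exists N; split=> //; apply: subset_trans hN => x /= hx H; apply: hx => e e0.
  by have [m um] := H e e0; exists (C m); case: (CP m).
- pose q n y := (avg n.+1 (\1_(ev s)) y - uavg (\1_(ev s)) y) ^+ 2.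
  have bq n : @bmeas _ (Borel rho) R (q n).
    by apply: bmeasM; apply: bmeasB; (exact: bmeas_bavg || exact: bmeas_usup).
  have E1 y : `|\1_(ev s) y : R| <= 1.
    by rewrite indicE; case: (_ \in _); rewrite ?normr0 ?normr1.
  apply: (@ae_small _ _ _ mu (fun n => uavg (q n))) => [n|n x|e e0].
  + exact: bmeas_usup.
  + by apply: usup_ge0 => // y; exact: sqr_ge0.
  have : (\int[mu]_x q n x) @[n --> \oo] --> \int[mu]_x (0 : R).
    apply: (@Rint_cvg_ae _ _ _ _ _ _ 4) => // [n x||].
    * rewrite normrX (_ : 4 = 2 ^+ 2); last by rewrite expr2; lra.
      rewrite lerXn2r ?nnegrE//; apply: le_trans (ler_normB _ _) _.
      have := @bavg_bound _ (Borel rho) R T n.+1 _ x 1 E1; have := @usup_bound _ (Borel rho) R T _ x 1 E1.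
      by move=> *; lra.
    * exact: bmeas_cst.
    have [_] := birkhoff mT muT bE; apply: filterS => x cx.
    have c0 : (avg n.+1 (\1_(ev s)) x - uavg (\1_(ev s)) x) @[n --> \oo] --> (0 : R).
      apply/cvgnP => r /((cvgnP _ _).1 cx)[N hN]; exists N => n Nn.
      by rewrite subr0; apply: hN; exact: leqW.
    by rewrite -[X in _ --> X](mulr0 (0 : R)); exact: (cvgM c0 c0).
  rewrite Rint_cst => /cvgnP/(_ _ e0)[n /(_ n (leqnn n))].
  rewrite subr0 => /ltW h; exists n.
  by have [-> _] := birkhoff mT muT (bq n); exact: le_trans (ler_norm _) h.
Unshelve. all: by end_near. Qed.

End GoodPoints.
Arguments good_point {R X} rho T b x.
(** A copy of [X] that carries the algebra of the sets named by terms; [T] and [b] are arguments so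
    that this structure can depend on them. *)
Definition term_algebra (X : pointedType) (T : X -> X) (b : nat -> set X) : Type := X.

Section TermAlgebra.
Variables (X : pointedType) (T : X -> X) (b : nat -> set X).

Lemma term_algebra0 : range (ev T b) set0.
Proof. by exists (And (Atom 0) (Neg (Atom 0))) => //=; rewrite setICr. Qed.

Lemma term_algebraU : setU_closed (range (ev T b)).
Proof.
move=> _ _ [s _ <-] [s' _ <-]; exists (Neg (And (Neg s) (Neg s'))) => //=.
by rewrite setCI !setCK.
Qed.

Lemma term_algebraC : setC_closed (range (ev T b)).
Proof. by move=> _ [s _ <-]; exists (Neg s). Qed.

HB.instance Definition _ := Pointed.on (term_algebra T b).
HB.instance Definition _ := isAlgebraOfSets.Build default_measure_display
  (term_algebra T b) term_algebra0 term_algebraU term_algebraC.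

End TermAlgebra.

Section ComponentMeasure.
Variables (R : realType) (X : pointedType) (rho : X -> X -> R) (T : X -> X).
Hypothesis cT : rho_continuous rho T.
Variable b : nat -> set X.
Hypothesis mb : forall n, measurable (b n : set (Borel rho)).
Hypothesis gb : rho_open rho `<=` <<s range b >>.
Variable x : X.
Hypothesis gx : good_point rho T b x.

Notation avg := (@bavg _ (Borel rho) R T).
Notation uavg := (@usup _ (Borel rho) R T).
Notation Alg := (term_algebra T b).

Definition freq (A : set Alg) : \bar R := (uavg (\1_A) x)%:E.

Lemma freq_cvg (A : set Alg) : measurable A ->
  (avg n (\1_A) x) @[n --> \oo] --> uavg (\1_A) x.
Proof. by case=> s _ <-; have [+ _ _] := gx; exact. Qed.

Lemma freq0 : freq set0 = 0%E.
Proof.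
congr EFin; apply: usup_cvg; apply/cvgnP => e e0; exists 0%N => n _.
by rewrite /bavg /bsum big1 ?mulr0 ?subrr ?normr0// => i _; rewrite indic0.
Qed.

Lemma freq_ge0 A : (0 <= freq A)%E.
Proof.
rewrite lee_fin; apply: (@limn_sup_ge _ _ 1) => [n|N].
  apply: bavg_bound => y; rewrite indicE.
  by case: (_ \in _); rewrite ?normr0 ?normr1.
exists N => //; rewrite mulr_ge0 ?invr_ge0//.
by apply: sumr_ge0 => j _; rewrite indicE.
Qed.

Lemma freqU (A B : set Alg) : measurable A -> measurable B -> A `&` B = set0 ->
  freq (A `|` B) = (freq A + freq B)%E.
Proof.
move=> mA mB AB; rewrite /freq -EFinD; congr EFin; apply: usup_cvg.
rewrite [X in X @ _ --> _](_ : _ = fun n => avg n (\1_A) x + avg n (\1_B) x).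
  by apply: cvgD; exact: freq_cvg.
apply/funext => n; rewrite -bavgD; apply: eq_bavg => y; rewrite !indicE in_setU.
have [/set_mem Ay|_] := boolP (y \in A); last by rewrite add0r.
by rewrite memNset ?addr0// => By; have : set0 y by rewrite -AB.
Qed.

(* Tightness of the frequencies: a decreasing sequence with empty intersection is
   approximated by closed compact sets, finitely many of which have empty intersection. *)
Lemma freq_vanish (B : nat -> set Alg) : (forall n, measurable (B n)) ->
  (forall n, B n.+1 `<=` B n) -> \bigcap_n B n = set0 ->
  forall e : R, 0 < e -> exists n, uavg (\1_(B n)) x <= e.
Proof.
move=> mB dB B0 e e0; have dB' := decr_subset dB.
have h n : exists C : set X, [/\ rho_closed rho C, chain_compact rho C,
    C `<=` B n & uavg (\1_(B n `\` C)) x < e / (2 ^ n.+1)%:R].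
  have [s _ <-] := mB n; have [_ + _] := gx; apply.
  by rewrite divr_gt0// ltr0n expn_gt0.
have [C CP] := choice h.
pose F n := \bigcap_(i < n.+1) C i.
have cF n : rho_closed rho (F n).
  rewrite /F bigcap_mkcond; apply: rho_closed_bigcap => i.
  by case: ifP => _; [case: (CP i)|rewrite /rho_closed setCT].
have [n Fn] : exists n, F n = set0.
  apply: contrapT => /forallNP nF.
  have kC0 : chain_compact rho (C 0%N) by case: (CP 0%N).
  have [||||y Fy] := kC0 F => //.
  - by move=> n y Fy i /= ni; apply: Fy; rewrite /= (leq_trans ni).
  - by move=> y; apply.
  - by move=> n; exact/set0P/eqP/nF.
  have : (\bigcap_n B n) y; last by rewrite B0.
  by move=> n _; have [_ _ + _] := CP n; apply; apply: (Fy n I) => /=.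
exists n.
have mBC i : measurable (B i `\` C i : set (Borel rho)).
  have [s _ <-] := mB i; apply: measurableD; first exact: measurable_ev.
  by apply: measurable_closed; case: (CP i).
have mBn : measurable (B n : set (Borel rho)).
  by have [s _ <-] := mB n; exact: measurable_ev.
apply: (@le_trans _ _ (uavg (\1_(\bigcup_(i < n.+1) (B i `\` C i))) x)).
  apply: le_usup; [exact: bmeas_indic| |move=> y].
    by apply: bmeas_indic; exact: bigcup_measurable.
  rewrite !indicE; have [/set_mem By|_] := boolP (y \in B n); last by [].
  rewrite mem_set//.
  have : ~ F n y by rewrite Fn.
  move=> /existsNP[i /not_implyP[/= ni nC]]; exists i => //; split=> //.
  exact: dB' By.
apply: le_trans (usup_bigcup _ _ _ mBC) _.
apply: (@le_trans _ _ (\sum_(i < n.+1) e / (2 ^ i.+1)%:R)).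
  by apply: ler_sum => i _; case: (CP i) => _ _ _ /ltW.
rewrite -lee_fin -sumEFin -(big_mkord xpredT (fun i => (e / (2 ^ i.+1)%:R)%:E)).
apply: le_trans (epsilon_trick0 xpredT (ltW e0)).
by apply: nneseries_lim_ge => i _; rewrite lee_fin divr_ge0// ltW.
Qed.

Lemma freq_bigsetU (F : nat -> set Alg) n : (forall i, measurable (F i)) ->
  trivIset setT F -> freq (\bigcup_(i < n) F i) = (\sum_(i < n) freq (F i))%E.
Proof.
move=> mF tF; elim: n => [|n IH].
  by rewrite bigcup_mkord !big_ord0 freq0.
rewrite bigcup_mkord !big_ord_recr /= -bigcup_mkord freqU ?IH//.
  by rewrite bigcup_mkord; exact: bigsetU_measurable.
rewrite -subset0 => y [[i /= ni Fi] Fn].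
move/trivIsetP: tF => /(_ i n I I); rewrite (ltn_eqF ni) => /(_ isT).
move=> FF; suff : (F i `&` F n) y by rewrite FF.
by split.
Qed.

Lemma freq_sigma_additive : semi_sigma_additive freq.
Proof.
move=> F mF tF mUF.
have mG n : measurable (\bigcup_(i < n) F i : set Alg).
  by rewrite bigcup_mkord; exact: bigsetU_measurable.
(* These remainders lie in the algebra and decrease to the empty set, so [freq_vanish] makes their
   frequencies small. *)
pose Rm n := (\bigcup_i F i) `\` \bigcup_(i < n) F i.
have mR n : measurable (Rm n : set Alg) by exact: measurableD.
have dR n : Rm n.+1 `<=` Rm n.
  move=> y [Fy ny]; split=> // -[i /= ni Fi]; apply: ny; exists i => //=.
  exact: leq_trans ni (leqnSn _).
have R0 : \bigcap_n Rm n = set0.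
  rewrite -subset0 => y Ry; have [[i _ Fi] _] := Ry 0%N I.
  by have [_] := Ry i.+1 I; apply; exists i => /=.
have freqE n : freq (\bigcup_i F i) = (\sum_(i < n) freq (F i) + freq (Rm n))%E.
  rewrite -freq_bigsetU// -freqU//; last first.
    by rewrite -subset0 => y [Fy [_]]; apply.
  congr freq; apply/seteqP; split=> y; last by case=> [[i _ Fi]|[]//]; exists i.
  by move=> Fy; have [|] := pselect ((\bigcup_(i < n) F i) y); [left|right].
have fR n : freq (Rm n) = (uavg (\1_(Rm n)) x)%:E by [].
apply/fine_cvgP; split.
  by apply: nearW => n; rewrite big_mkord sumEFin.
apply/cvgnP => e e0; have e20 : 0 < e / 2 by rewrite divr_gt0.
have [N hN] := freq_vanish mR dR R0 e20; exists N => n Nn.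
rewrite /= big_mkord sumEFin /=.
have := freqE n; rewrite sumEFin => -[->].
rewrite opprD addrA subrr add0r normrN ger0_norm; last exact: (freq_ge0 (Rm n)).
apply: (@le_lt_trans _ _ (e / 2)); last by lra.
apply: le_trans hN.
have mB k : measurable (Rm k : set (Borel rho)).
  by have [s _ <-] := mR k; exact: measurable_ev.
apply: le_usup; [exact: bmeas_indic|exact: bmeas_indic|move=> y].
rewrite !indicE; have [/set_mem By|_] := boolP (y \in Rm n); last by [].
by rewrite mem_set//; exact: (decr_subset dR Nn).
Qed.

HB.instance Definition _ := isMeasure.Build _ Alg R freq freq0 freq_ge0
  freq_sigma_additive.

(** Caratheodory's extension of the frequencies. It is a measure on the sigma-algebra generated by
    the terms, which [sigma_term_algebra] identifies with the Borel sets. *)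
Definition component : set (Borel rho) -> \bar R := measure_extension freq.

Lemma component_ev s : component (ev T b s) = (uavg (\1_(ev T b s)) x)%:E.
Proof.
rewrite /component /measure_extension measurable_mu_extE//.
exact: (ex_intro2 _ _ s I erefl).
Qed.

Lemma sigma_term_algebra : measurable = <<s range (ev T b) >> :> set (set (Borel rho)).
Proof.
apply/seteqP; split.
  apply: smallest_sub; first exact: smallest_sigma_algebra.
  apply: subset_trans gb _; apply: sub_smallest2r; first exact: smallest_sigma_algebra.
  by move=> _ [n _ <-]; exists (Atom n).
apply: smallest_sub; first exact: smallest_sigma_algebra.
by move=> _ [s _ <-]; exact: measurable_ev.
Qed.

Let component0 : component set0 = 0%E.
Proof. exact: measure0. Qed.

Let component_ge0 A : (0 <= component A)%E.
Proof. exact: measure_ge0. Qed.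

Let component_sigma_additive : semi_sigma_additive component.
Proof.
move=> F mF tF mUF; apply: (@measure_semi_sigma_additive _ _ _ (measure_extension freq)) => //.
  by move=> i; have := mF i; rewrite sigma_term_algebra.
by move: mUF; rewrite sigma_term_algebra.
Qed.

HB.instance Definition _ := isMeasure.Build _ (Borel rho) R component
  component0 component_ge0 component_sigma_additive.

Let componentT : component setT = 1%E.
Proof.
rewrite (_ : setT = ev T b (Neg (And (Atom 0) (Neg (Atom 0))))); last first.
  by rewrite /= setICr setC0.
rewrite component_ev /= setICr setC0; congr EFin; apply: usup_cvg.
apply/cvgnP => e e0; exists 1%N => -[//|n] _.
by rewrite indicT bavg_cst subrr normr0.
Qed.

HB.instance Definition _ := Measure_isProbability.Build _ _ _ component componentT.

Lemma component_probability : exists nu : probability (Borel rho) R,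
  forall s, nu (ev T b s) = (uavg (\1_(ev T b s)) x)%:E.
Proof. by exists component => s; exact: component_ev. Qed.

End ComponentMeasure.

(** * Ergodicity of the measure of a typical point *)

Section ErgodicComponent.
Variables (R : realType) (X : pointedType) (rho : X -> X -> R) (T : X -> X).
Hypothesis cT : rho_continuous rho T.
Variable b : nat -> set X.
Hypothesis mb : forall n, measurable (b n : set (Borel rho)).
Hypothesis gb : rho_open rho `<=` <<s range b >>.
Variable x : X.
Hypothesis gx : good_point rho T b x.
Variable nu : probability (Borel rho) R.

Notation avg := (@bavg _ (Borel rho) R T).
Notation uavg := (@usup _ (Borel rho) R T).
Notation ev := (ev T b).

Hypothesis nuE : forall s, nu (ev s) = (uavg (\1_(ev s)) x)%:E.

Let mT : measurable_fun setT (T : Borel rho -> Borel rho) := measurable_T cT.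
Let mE s : measurable (ev s : set (Borel rho)) := measurable_ev cT mb s.
Let bE s : bmeas (\1_(ev s) : Borel rho -> R) := bmeas_indic (mE s).

Definition top_term := Neg (And (Atom 0) (Neg (Atom 0))).

Lemma ev_top : ev top_term = setT.
Proof. by rewrite /= setICr setC0. Qed.

(** The sets named by terms form a pi-system that generates the Borel sets. Measures of any finite
    mass are allowed because ergodicity compares a restriction of [nu] with a multiple of [nu]. *)
Lemma term_measure_unique (m1 m2 : {measure set (Borel rho) -> \bar R}) :
  (m1 setT < +oo)%E -> (forall s, m1 (ev s) = m2 (ev s)) ->
  forall A : set (Borel rho), measurable A -> m1 A = m2 A.
Proof.
move=> m1T m12 A mA.
apply: (@measure_unique _ R (Borel rho) (range ev) (fun=> setT) _ _ _ _ m1 m2 _ _ A mA) => //.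
- exact: sigma_term_algebra.
- by move=> _ _ [s _ <-] [s' _ <-]; exists (And s s').
- by move=> _; rewrite -ev_top; exists top_term.
- by rewrite bigcup_const//; exists 0%N.
- by move=> _ [s _ <-].
Qed.

Lemma component_invariant : invariant_prob rho T nu.
Proof.
move=> A mA.
have -> : nu (T @^-1` A) = pushforward nu (T : Borel rho -> Borel rho) A by [].
apply: term_measure_unique mA => [|s]; rewrite /= /pushforward.
  by rewrite preimage_setT -ge0_fin_numE ?fin_num_measure.
rewrite (nuE (Pre s)) nuE; congr EFin.
rewrite -(@usup_comp _ (Borel rho) R T _ x (bE s)); congr limn_sup; apply/funext => n.
rewrite /bavg /bsum; congr (_ * _); apply: eq_bigr => j _.
by rewrite -iterSr !indicE; congr ((_ : bool)%:R); apply/idP/idP; rewrite !inE.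
Qed.

(** Functions whose averages at [x] converge to their [nu]-integrals. Stability under products and
    under [T] brings in the squared deviations of time averages from a constant, on which ergodicity
    rests. *)
Inductive simple : (X -> R) -> Prop :=
| simple_ev s : simple (\1_(ev s))
| simpleD f g : simple f -> simple g -> simple (fun y => f y + g y)
| simpleZ c f : simple f -> simple (fun y => c * f y).

Lemma simple_cst c : simple (fun=> c).
Proof.
have := simpleZ c (simple_ev top_term); congr simple; apply/funext => y.
by rewrite ev_top indicT mulr1.
Qed.

Lemma simpleM f g : simple f -> simple g -> simple (fun y => f y * g y).
Proof.
move=> sf sg; elim: sf => [s|f1 f2 _ IH1 _ IH2|c f1 _ IH1].
- elim: sg => [s'|g1 g2 _ IH1 _ IH2|c g1 _ IH1].
  + have := simple_ev (And s s'); congr simple; apply/funext => y.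
    by rewrite /= indicI.
  + have := simpleD IH1 IH2; congr simple; apply/funext => y; by rewrite mulrDr.
  + have := simpleZ c IH1; congr simple; apply/funext => y; by rewrite mulrCA.
- have := simpleD IH1 IH2; congr simple; apply/funext => y; by rewrite mulrDl.
- have := simpleZ c IH1; congr simple; apply/funext => y; by rewrite mulrA.
Qed.

Lemma simple_comp f : simple f -> simple (fun y => f (T y)).
Proof.
elim=> [s|f1 f2 _ IH1 _ IH2|c f1 _ IH1]; last 2 first.
- exact: simpleD IH1 IH2.
- exact: simpleZ IH1.
exact: simple_ev (Pre s).
Qed.

Lemma simple_bavg n f : simple f -> simple (avg n f).
Proof.
move=> sf; apply: simpleZ; elim: n => [|n IH].
  have := simple_cst 0; congr simple; apply/funext => y; by rewrite /bsum big_ord0.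
have sn : simple (fun y => f (iter n T y)).
  elim: (n) => // k IHk; have := simple_comp IHk.
  congr simple; apply/funext => y; by rewrite iterSr.
have := simpleD IH sn; congr simple; apply/funext => y; by rewrite bsumSr.
Qed.

Lemma bmeas_simple f : simple f -> @bmeas _ (Borel rho) R f.
Proof.
by elim=> [s|f1 f2 _ IH1 _ IH2|c f1 _ IH1]; [exact: bE|exact: bmeasD|exact: bmeasZ].
Qed.

Lemma simple_cvg f : simple f -> (avg n f x) @[n --> \oo] --> \int[nu]_y f y.
Proof.
elim=> [s|f1 f2 s1 IH1 s2 IH2|c f1 s1 IH1].
- rewrite Rint_indic// nuE /=; have [+ _ _] := gx; exact.
- rewrite RintD; [|exact: bmeas_simple|exact: bmeas_simple].
  under eq_fun do rewrite bavgD; exact: cvgD.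
- rewrite RintZ; last exact: bmeas_simple.
  under eq_fun do rewrite bavgZ; apply: cvgM => //; exact: cvg_cst.
Qed.

(* [nu (A `&` B)] is the integral of [1_A] against the time averages of [1_B], and these
   are close to the constant [nu B] in L^2(nu). *)
Lemma component_independent (A : set (Borel rho)) s : measurable A -> T @^-1` A = A ->
  fine (nu (A `&` ev s)) = fine (nu A) * fine (nu (ev s)).
Proof.
move=> mA TA; set c := fine (nu (ev s)).
have bA := bmeas_indic (R := R) mA.
have cE : c = uavg (\1_(ev s)) x by rewrite /c nuE.
pose q n y : R := (avg n.+1 (\1_(ev s)) y - c) ^+ 2.
have sq n : simple (q n).
  have sB : simple (fun y => avg n.+1 (\1_(ev s)) y - c).
    by apply: simpleD; [exact/simple_bavg/simple_ev|exact: simple_cst].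
  exact: simpleM.
have bq n := bmeas_simple (sq n).
(* The last clause of [good_point] subtracts the upper average at the running point. Along the orbit
   of [x] this is the constant [c], so the clause bounds the upper average of [q n] at [x], which is
   its integral. *)
have small e : 0 < e -> exists n, \int[nu]_y q n y < e.
  have [_ _ h] := gx; move=> /(h s)[n hn]; exists n.
  rewrite -(usup_cvg (simple_cvg (sq n))); apply: le_lt_trans hn.
  rewrite le_eqVlt; apply/orP; left; apply/eqP; congr limn_sup; apply/funext => N.
  rewrite /bavg /bsum; congr (_ * _); apply: eq_bigr => j _.
  by rewrite /q cE usup_iter.
have inA j y : \1_A (iter j T y) = \1_A y :> R.
  elim: j y => // j IH y; rewrite iterSr IH.
  by rewrite !indicE; congr ((_ : bool)%:R); rewrite -{2}TA; apply/idP/idP; rewrite !inE.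
(* [A] and [nu] are both invariant, so replacing the indicator of [ev s] by its time average does
   not change the integral over [A]. *)
have muAB n : \int[nu]_y (\1_A y * avg n.+1 (\1_(ev s)) y) = fine (nu (A `&` ev s)).
  have -> : fine (nu (A `&` ev s)) = \int[nu]_y (\1_A y * \1_(ev s) y).
    rewrite -Rint_indic; last exact: measurableI.
    by apply: eq_Rintegral => y _; rewrite indicI.
  set g := fun y => \1_A y * \1_(ev s) y : R.
  have bg : @bmeas _ (Borel rho) R g by exact: bmeasM.
  transitivity (\int[nu]_y (n.+1%:R^-1 * \sum_(j < n.+1) g (iter j T y))).
    apply: eq_Rintegral => y _; rewrite mulrCA; congr (_ * _).
    by rewrite mulr_sumr; apply: eq_bigr => j _; rewrite /g inA.
  have bgj (j : 'I_n.+1) : @bmeas _ (Borel rho) R (fun y => g (iter j T y)).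
    exact: (bmeas_comp (measurable_iter mT j) bg).
  rewrite RintZ; last exact: bmeas_sum.
  rewrite Rint_sum//.
  under eq_bigr => j _ do rewrite (Rint_iter mT component_invariant j bg).
  by rewrite sumr_const card_ord -[(\int[nu]_x g x) *+ _]mulr_natl mulrA mulVf ?mul1r.
(* The inequality [|a| <= e + a^2 / e] replaces that of Cauchy and Schwarz. *)
have bnd e n : 0 < e -> `|fine (nu (A `&` ev s)) - fine (nu A) * c| <=
    e + e^-1 * \int[nu]_y q n y.
  move=> e0; rewrite -(muAB n) -(Rint_indic nu mA) mulrC -RintZ// -RintB; last 2 first.
  - by apply: bmeasM => //; exact: bmeas_bavg.
  - exact: bmeasZ.
  have bd : @bmeas _ (Borel rho) R (fun y => \1_A y * avg n.+1 (\1_(ev s)) y - c * \1_A y).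
    apply: bmeasB; last exact: bmeasZ.
    by apply: bmeasM => //; exact: bmeas_bavg.
  have bR : @bmeas _ (Borel rho) R (fun y => e + e^-1 * q n y).
    by apply: bmeasD; [exact: bmeas_cst|exact: bmeasZ].
  have -> : e + e^-1 * \int[nu]_y q n y = \int[nu]_y (e + e^-1 * q n y).
    by rewrite RintD ?Rint_cst ?RintZ//; [exact: bmeas_cst|exact: bmeasZ].
  have key y : `|\1_A y * avg n.+1 (\1_(ev s)) y - c * \1_A y| <= e + e^-1 * q n y.
    rewrite [c * _]mulrC -mulrBr normrM /q; set a := avg _ _ y - c.
    apply: (@le_trans _ _ `|a|).
      rewrite ler_piMl// indicE; case: (_ \in _); by rewrite ?normr1 ?normr0.
    rewrite -(ler_pM2l e0) mulrDr mulrA mulfV ?gt_eqF// mul1r -real_normK ?num_real//.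
    have := sqr_ge0 (e - `|a|); have := mulr_ge0 (ltW e0) (normr_ge0 a); nra.
  rewrite ler_norml; apply/andP; split; last first.
    by apply: le_Rint => // y; apply: le_trans (key y); exact: ler_norm.
  rewrite -mulN1r -RintZ//; apply: le_Rint => //; first exact: bmeasZ.
  by move=> y; rewrite mulN1r lerNl; apply: le_trans (key y); rewrite -normrN; exact: ler_norm.
apply/eqP; rewrite -subr_eq0 -normr_eq0 eq_le normr_ge0 andbT.
apply/ler_addgt0Pr => e e0; rewrite add0r.
have e20 : 0 < e / 2 by rewrite divr_gt0.
have [n hn] := small _ (mulr_gt0 e20 e20).
apply: le_trans (bnd _ n e20) _.
have : (e / 2)^-1 * \int[nu]_y q n y <= e / 2; last by lra.
by rewrite ler_pdivrMl// ltW.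
Qed.

(** Independence of [A] from the terms extends to all Borel sets by uniqueness of measures. Taken at
    [A] itself it gives [nu A = (nu A)^2]. *)
Lemma component_ergodic : ergodic rho T nu.
Proof.
split; first exact: component_invariant.
move=> A mA TA; have nA : nu A \is a fin_num by exact: fin_num_measure.
have a0 : 0 <= fine (nu A) by rewrite fine_ge0.
have h : mrestr nu mA A = mscale (NngNum a0) nu A.
  apply: (term_measure_unique _ _ mA) => [|s].
    by rewrite /= /mrestr setTI -ge0_fin_numE.
  have mAs : measurable (A `&` ev s) by exact: measurableI.
  have mS := mE s.
  rewrite /= /mrestr /mscale /= setIC -(fineK (fin_num_measure nu _ mAs)).
  rewrite -(fineK (fin_num_measure nu _ mS)) -EFinM; congr EFin.
  exact: component_independent.
move: h; rewrite /mrestr /mscale /= setIid -(fineK nA) -EFinM => -[].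
move=> h; have /eqP : fine (nu A) * (fine (nu A) - 1) = 0 by lra.
by rewrite mulf_eq0 => /orP[/eqP ->|]; [left|rewrite subr_eq0 => /eqP ->; right].
Qed.

End ErgodicComponent.

(** * Ergodic measures with large integrals *)

Section LevelSets.
Variable R : realType.

(** The sum is the integer part of [a * (k + 1)]. This gives the uniform approximation of a function
    with values in the unit interval by indicators of its level sets. *)
Lemma level_count (k : nat) (a : R) : 0 <= a <= 1 ->
  `|a - k.+1%:R^-1 * \sum_(i < k.+1) ((i.+1%:R / k.+1%:R <= a)%R : nat)%:R| <= k.+1%:R^-1.
Proof.
move=> /andP[a0 a1]; set K : R := k.+1%:R; have K0 : 0 < K by rewrite ltr0n.
pose m := Num.truncn (a * K).
have /andP[m1 m2] : m%:R <= a * K < m.+1%:R by rewrite truncn_itv// mulr_ge0// ltW.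
have mk : (m <= k.+1)%N.
  by rewrite -(ler_nat R); apply: le_trans m1 _; rewrite ler_piMl// ltW.
have -> : \sum_(i < k.+1) ((i.+1%:R / K <= a)%R : nat)%:R = m%:R :> R.
  rewrite (eq_bigr (fun i : 'I_k.+1 => ((i < m)%N : nat)%:R)) => [|i _]; last first.
    rewrite ler_pdivrMr//; congr ((_ : bool) : nat)%:R; apply/idP/idP => h.
      rewrite -ltnS -(ltr_nat R); exact: le_lt_trans m2.
    by apply: le_trans m1; rewrite ler_nat.
  rewrite -natr_sum; congr (_%:R).
  rewrite (eq_bigr (fun i : 'I_k.+1 => if (i < m)%N then 1%N else 0%N)) => [|i _].
    by rewrite -big_mkcond /= -(big_ord_widen k.+1 (fun=> 1%N) mk) sum1_card card_ord.
  by case: ifP.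
have -> : a - K^-1 * m%:R = K^-1 * (a * K - m%:R).
  by rewrite mulrBr mulrCA mulVf ?mulr1// gt_eqF.
have Ki0 : 0 <= K^-1 by rewrite invr_ge0 ltW.
rewrite normrM (ger0_norm Ki0) ler_piMr//.
rewrite ger0_norm ?subr_ge0//; move: m2; rewrite -natr1; lra.
Qed.

End LevelSets.

Section ErgodicMeasures.
Variables (R : realType) (X : pointedType) (rho : X -> X -> R) (T : X -> X).
Hypotheses (rhoM : is_metric rho) (rhoX : rho_complete rho) (rhoS : rho_separable rho).
Hypothesis cT : rho_continuous rho T.

(** The sets [c] are added to small balls around a dense sequence, so that the level sets of a given
    function become atoms and have frequencies at typical points. *)
Lemma generating_sequence (c : nat -> set X) : (forall n, measurable (c n : set (Borel rho))) ->
  exists b : nat -> set X, [/\ forall n, measurable (b n : set (Borel rho)),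
    rho_open rho `<=` <<s range b >> & forall n, exists m, b m = c n].
Proof.
move=> mc; have [D dD] := dense_sequence rhoM rhoS.
pose b n : set X := match unpickle n with
  | Some (inl (i, m)) => [set y | rho (D i) y < m.+1%:R^-1]
  | Some (inr n) => c n
  | None => set0
  end.
exists b; split=> [n|U oU|n].
- rewrite /b; case: (unpickle n) => [[[i m]|k]|]; last exact: measurable0.
    by apply: measurable_open; exact: rho_open_ball.
  exact: mc.
- have -> : U = \bigcup_n (if pselect (b n `<=` U) then b n else set0).
    apply/seteqP; split=> y; last first.
      by case=> n _; case: pselect => // bU /bU.
    move=> /oU[e e0 eU]; have e20 : 0 < e / 2 by rewrite divr_gt0.
    have [m _ me] := near_infty_natSinv_lt (PosNum e20).
    have {}me : m.+1%:R^-1 < e / 2 by exact: (me m (leqnn m)).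
    have [|i yi] := dD y m.+1%:R^-1; first by rewrite invr_gt0.
    exists (pickle (inl (i, m) : (nat * nat) + nat)) => //.
    have bE : b (pickle (inl (i, m) : (nat * nat) + nat)) = [set y | rho (D i) y < m.+1%:R^-1].
      by rewrite /b pickleK.
    rewrite bE; case: pselect => // -[] z /= iz; apply: eU.
    have := rho_triangle rhoM y (D i) z; rewrite (rhoC rhoM y (D i)).
    by move: (m.+1%:R^-1) me yi iz => r; lra.
  apply: sigma_algebra_bigcup => n; case: pselect => ? /=; last exact: sigma_algebra0.
  by apply: sub_sigma_algebra; exists n.
- exists (pickle (inr n : (nat * nat) + nat)); by rewrite /b pickleK.
Qed.

Variable mu : probability (Borel rho) R.
Hypothesis muT : invariant_prob rho T mu.

Notation avg := (@bavg _ (Borel rho) R T).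
Notation uavg := (@usup _ (Borel rho) R T).

(** [usup f] has the same integral as [f], so some typical point makes it exceed that integral minus
    [e]. The averages of [f] there converge to the integral against the ergodic measure of the
    point, because [f] is a uniform limit of combinations of atoms. *)
Lemma unit_ergodic_ge (f : X -> R) (e : R) :
  measurable_fun setT (f : Borel rho -> R) -> (forall y, 0 <= f y <= 1) -> 0 < e ->
  exists2 nu : probability (Borel rho) R, ergodic rho T nu &
    \int[mu]_y f y - e < \int[nu]_y f y.
Proof.
move=> mf f01 e0.
have bf : @bmeas _ (Borel rho) R f.
  split=> //; exists 1 => y; have /andP[h0 h1] := f01 y; by rewrite ger0_norm.
pose L k i : set X := [set y | i.+1%:R / k.+1%:R <= f y].
have mL k i : measurable (L k i : set (Borel rho)).
  rewrite [L k i](_ : _ = setT `&` f @^-1` `[i.+1%:R / k.+1%:R, +oo[).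
    by apply: mf => //; exact: measurable_itv.
  by rewrite setTI; apply/seteqP; split=> y /=; rewrite /L/= in_itv /= andbT.
pose c n := if unpickle n is Some (k, i) then L k i else set0.
have mc n : measurable (c n : set (Borel rho)).
  by rewrite /c; case: unpickle => [[k i]|].
have [b [mb gb bc]] := generating_sequence mc.
have Lb k i : exists n, b n = L k i.
  by have [n nE] := bc (pickle (k, i)); exists n; rewrite nE /c pickleK.
have ae := ae_good_point rhoM rhoX rhoS cT mb muT.
have [uI _] := birkhoff (measurable_T cT) muT bf.
have [||x gx fx] := ae_exists_gt ae (g := uavg f) (c := \int[mu]_y f y - e).
- by apply: bmeas_usup => //; exact: measurable_T.
- by rewrite uI; lra.
have [nu nuE] := component_probability cT mb gb gx.
exists nu; first exact: component_ergodic nuE.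
suff -> : \int[nu]_y f y = uavg f x by [].
apply/esym/usup_cvg.
pose F k y : R := k.+1%:R^-1 * \sum_(i < k.+1) \1_(L k i) y.
have sF k : simple T b (F k).
  apply: simpleZ; elim: (index_enum _) => [|i r IH].
    have := simple_cst T b (0 : R); congr simple; apply/funext => y; by rewrite big_nil.
  have [n nE] := Lb k i.
  have := simpleD (simple_ev R T b (Atom n)) IH; congr simple; apply/funext => y.
  by rewrite /= nE big_cons.
have bF k : @bmeas _ (Borel rho) R (F k) by exact: bmeas_simple (sF k).
have Ff k y : `|f y - F k y| <= k.+1%:R^-1.
  rewrite /F (eq_bigr (fun i : 'I_k.+1 => ((i.+1%:R / k.+1%:R <= f y)%R : nat)%:R)).
    exact: level_count.
  by move=> i _; rewrite indicE; congr ((_ : bool) : nat)%:R; apply/idP/idP; rewrite inE.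
apply/cvgnP => r r0; have r30 : 0 < r / 3 by rewrite divr_gt0.
have [k _ kr] := near_infty_natSinv_lt (PosNum r30).
have {}kr : k.+1%:R^-1 < r / 3 by exact: (kr k (leqnn k)).
have /cvgnP/(_ _ r30)[N hN] := simple_cvg cT mb gx nuE (sF k).
exists N => n Nn; have {}hN := hN n Nn.
have h1 : `|avg n f x - avg n (F k) x| <= k.+1%:R^-1.
  have -> : avg n f x - avg n (F k) x = avg n (fun y => f y - F k y) x.
    by rewrite /bavg /bsum -mulrBr -sumrB.
  exact: bavg_bound.
have h2 : `|\int[nu]_y f y - \int[nu]_y F k y| <= k.+1%:R^-1 by exact: Rint_dist.
move: h1 h2 hN kr; move: (_ ^-1) => s.
rewrite !ler_norml !ltr_norml => /andP[? ?] /andP[? ?] /andP[? ?] ?.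
by apply/andP; split; lra.
Qed.

Lemma bounded_ergodic_ge (f : X -> R) (e : R) : @bmeas _ (Borel rho) R f -> 0 < e ->
  exists2 nu : probability (Borel rho) R, ergodic rho T nu &
    \int[mu]_y f y - e < \int[nu]_y f y.
Proof.
move=> bf e0; have [mf [M0 fM0]] := bf.
pose M := M0 + 1; have M1 : 0 < M by have := le_trans (normr_ge0 _) (fM0 point); rewrite /M; lra.
pose g y := (2 * M)^-1 * (f y + M).
have M20 : 0 < 2 * M by rewrite mulr_gt0.
have bfM : @bmeas _ (Borel rho) R (fun y => f y + M) by apply: bmeasD => //; exact: bmeas_cst.
have bg : @bmeas _ (Borel rho) R g by exact: bmeasZ.
have [|y||nu erg h] := @unit_ergodic_ge g ((2 * M)^-1 * e); first exact: bg.1.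
- have := fM0 y; rewrite ler_norml => /andP[? ?]; apply/andP; split.
    by rewrite mulr_ge0 ?invr_ge0 ?(ltW M20)// /M; lra.
  by rewrite ler_pdivrMl// mulr1 /M; lra.
- by rewrite mulr_gt0// invr_gt0.
exists nu => //; move: h; rewrite /g !RintZ// !RintD//; try exact: bmeas_cst.
by rewrite !Rint_cst -mulrBr ltr_pM2l ?invr_gt0//; lra.
Qed.

End ErgodicMeasures.
(** * Linking periodic orbits *)

Section Orbits.
Variables (R : realType) (X : pointedType) (rho : X -> X -> R) (T : X -> X).

Notation S := (@bsum _ (Borel rho) R T).

Definition lipschitz_real (L : R) (g : X -> R) :=
  forall x y, `|g x - g y| <= L * rho x y.

Lemma bsum_add m n (g : X -> R) x : S (m + n) g x = S m g x + S n g (iter m T x).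
Proof.
elim: n => [|n IH]; first by rewrite addn0 /bsum big_ord0 addr0.
by rewrite addnS !bsumSr IH addrA -iterD addnC.
Qed.

Lemma bsum_shadow L g n p e x y : 0 <= L -> lipschitz_real L g -> (n <= p)%N ->
  bowen_ball rho T y p e x -> `|S n g x - S n g y| <= L * e * n%:R.
Proof.
move=> L0 Lg np xy; rewrite /bsum -sumrB.
apply: le_trans (ler_norm_sum _ _ _) _.
apply: (@le_trans _ _ (\sum_(j < n) L * e)).
  apply: ler_sum => j _; apply: le_trans (Lg _ _) _; apply: ler_wpM2l => //.
  by apply/ltW/xy; exact: leq_trans (ltn_ord j) np.
by rewrite sumr_const card_ord -[_ *+ n]mulr_natr.
Qed.

Lemma iter_periodic q k x : iter q T x = x -> iter (k * q) T x = x.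
Proof. by move=> qx; elim: k => // k IH; rewrite mulSn iterD IH. Qed.

Lemma bsum_periodic q k (g : X -> R) x : iter q T x = x ->
  S (k * q) g x = k%:R * S q g x.
Proof.
move=> qx; elim: k => [|k IH]; first by rewrite /bsum big_ord0 mul0r.
by rewrite mulSn bsum_add qx IH -add1n natrD mulrDl mul1r.
Qed.

(** Full periods contribute at most [d] per unit of time; the incomplete last one, shorter than [q],
    costs at most [2 * M * q]. *)
Lemma periodic_dev q (g : X -> R) x M m d n : iter q T x = x -> (0 < q)%N ->
  (forall y, `|g y| <= M) -> `|m| <= M -> 
  `|S q g x - q%:R * m| <= d * q%:R ->
  `|S n g x - n%:R * m| <= d * n%:R + 2 * M * q%:R.
Proof.
move=> qx q0 gM mM hd; set k := (n %/ q)%N; set r := (n %% q)%N.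
have nE : n = (k * q + r)%N by exact: divn_eq.
have d0 : 0 <= d.
  by rewrite -(@pmulr_lge0 _ q%:R) ?ltr0n//; exact: le_trans hd.
have M0 : 0 <= M by exact: le_trans mM.
have rq : (r < q)%N by rewrite ltn_mod.
have -> : S n g x - n%:R * m = k%:R * (S q g x - q%:R * m) + (S r g x - r%:R * m).
  have -> : S n g x = k%:R * S q g x + S r g x.
    by rewrite [in LHS]nE bsum_add bsum_periodic// iter_periodic.
  have -> : n%:R = k%:R * q%:R + r%:R :> R by rewrite [in LHS]nE natrD natrM.
  by ring.
apply: le_trans (ler_normD _ _) _; apply: lerD.
  rewrite normrM ger0_norm//; apply: (@le_trans _ _ (k%:R * (d * q%:R))).
    exact: ler_wpM2l.
  by rewrite mulrCA; apply: ler_wpM2l => //; rewrite -natrM ler_nat [leqRHS]nE leq_addr.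
apply: le_trans (ler_normB _ _) _.
have h1 := @bsum_bound _ (Borel rho) R T r g x M gM.
have h2 : `|r%:R * m| <= r%:R * M by rewrite normrM ger0_norm// ler_wpM2l.
have h3 : r%:R * M <= q%:R * M by rewrite ler_wpM2r// ler_nat ltnW.
lra.
Qed.

(** Every initial piece of the linked orbit is treated, since [link_step] controls intermediate
    times. Unshadowed times are at most a proportion [e] of the shadowed ones and cost at most [M]
    each. *)
Lemma link_sum z y1 y2 p1 q1 p2 q2 (e L M : R) g n : 0 <= e -> 0 <= L ->
  lipschitz_real L g -> (forall y, `|g y| <= M) ->
  (p1 <= q1)%N -> q1%:R <= (1 + e) * p1%:R -> bowen_ball rho T y1 p1 e z ->
  (p2 <= q2 - q1)%N -> (q2 - q1)%:R <= (1 + e) * p2%:R ->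
  bowen_ball rho T y2 p2 e (iter q1 T z) -> (n <= q2)%N ->
  let a := minn n p1 in let c := minn (n - q1) p2 in
  [/\ (a + c <= n)%N, n%:R <= (1 + e) * (a + c)%:R &
      `|S n g z - (S a g y1 + S c g y2)| <= (L + M) * e * (a + c)%:R].
Proof.
move=> e0 L0 Lg gM pq1 qe1 z1 pq2 qe2 z2 nq2 a c.
have M0 : 0 <= M by exact: le_trans (gM z).
(* [b1] and [b2] count the unshadowed times after the two pieces; truncated subtraction leaves the
   second piece empty until time [q1]. *)
pose b1 := (minn n q1 - a)%N; pose b2 := (n - q1 - c)%N.
have nE : n = (a + b1 + c + b2)%N by rewrite /b1 /b2 /a /c; lia.
have ap : (a <= p1)%N by rewrite /a; lia.
have cp : (c <= p2)%N by rewrite /c; lia.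
have hb1 : b1%:R <= e * a%:R.
  have [np|pn] := leqP n p1.
    have -> : b1 = 0%N by rewrite /b1 /a; lia.
    by rewrite mulr_ge0.
  have -> : a = p1 by rewrite /a; lia.
  have : b1%:R <= (q1 - p1)%:R :> R by rewrite ler_nat /b1 /a; lia.
  by rewrite (natrB _ pq1); lra.
have hb2 : b2%:R <= e * c%:R.
  have [np|pn] := leqP (n - q1) p2.
    have -> : b2 = 0%N by rewrite /b2 /c; lia.
    by rewrite mulr_ge0.
  have -> : c = p2 by rewrite /c; lia.
  have : b2%:R <= (q2 - q1 - p2)%:R :> R by rewrite ler_nat /b2 /c; lia.
  by rewrite (natrB _ pq2); lra.
split.
- by rewrite nE; lia.
- by rewrite {1}nE !natrD; lra.
have SE : S n g z = S a g z + S b1 g (iter a T z) + S c g (iter (a + b1) T z)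
    + S b2 g (iter (a + b1 + c) T z).
  by rewrite {1}nE !bsum_add.
have h1 : `|S a g z - S a g y1| <= L * e * a%:R by exact: bsum_shadow ap z1.
have h2 : `|S b1 g (iter a T z)| <= b1%:R * M by exact: bsum_bound.
have h3 : `|S c g (iter (a + b1) T z) - S c g y2| <= L * e * c%:R.
  have [c0|cn0] := eqVneq c 0%N; first by rewrite c0 /bsum !big_ord0 subrr normr0 mulr0.
  have -> : (a + b1 = q1)%N by move: cn0; rewrite /b1 /a /c; lia.
  exact: bsum_shadow cp z2.
have h4 : `|S b2 g (iter (a + b1 + c) T z)| <= b2%:R * M by exact: bsum_bound.
have -> : S n g z - (S a g y1 + S c g y2) = (S a g z - S a g y1) + S b1 g (iter a T z)
    + (S c g (iter (a + b1) T z) - S c g y2) + S b2 g (iter (a + b1 + c) T z).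
  by rewrite SE; ring.
have h5 : b1%:R * M <= e * a%:R * M by exact: ler_wpM2r.
have h6 : b2%:R * M <= e * c%:R * M by exact: ler_wpM2r.
apply: le_trans (ler_normD _ _) _; apply: le_trans (lerD (ler_normD _ _) (lexx _)) _.
apply: le_trans (lerD (lerD (ler_normD _ _) (lexx _)) (lexx _)) _.
by rewrite natrD; lra.
Qed.

Variable K : set X.
Hypothesis lK : linkable rho T K.

(* The definition of linkability does not bound [p1] and [p2] from below. Prescribing a
   ratio at distance [1 / (4 B)] from [Z / B], with [B] a multiple of [N`!], excludes
   every [p1 + p2 <= N]. *)
Lemma link_large y1 y2 (e lam : R) N : K y1 -> K y2 -> 0 < e -> 0 < lam < 1 ->
  exists p1 p2 q1 q2 z, [/\ (N <= p1)%N, (0 < p2)%N & [/\ K z, iter q2 T z = z,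
    `|p1%:R - lam * (p1 + p2)%:R| <= e * (p1 + p2)%:R,
    [/\ (p1 <= q1)%N, q1%:R <= (1 + e) * p1%:R & bowen_ball rho T y1 p1 e z] &
    [/\ (p2 <= q2 - q1)%N, (q2 - q1)%:R <= (1 + e) * p2%:R &
        bowen_ball rho T y2 p2 e (iter q1 T z)]]].
Proof.
move=> Ky1 Ky2 e0 /andP[l0 l1].
(* This margin keeps the perturbed ratio [lam'] in the unit interval and [p1 / (p1 + p2)] above
   [lam / 2], so that a large total length forces a long first piece. *)
pose e1 := Num.min (Num.min (e / 2) (lam / 2)) ((1 - lam) / 2).
have e10 : 0 < e1 by rewrite !lt_min !divr_gt0// subr_gt0.
have [e1e e1l e1l'] : [/\ e1 <= e / 2, e1 <= lam / 2 & e1 <= (1 - lam) / 2].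
  split; rewrite /e1 !ge_min lexx ?orbT//.
pose N' := Num.bound (N%:R / (lam / 2)).
have hN' : N%:R / (lam / 2) < N'%:R by apply: archi_boundP; rewrite divr_ge0// ltW// divr_gt0.
pose k := Num.bound (2 / e1).
have hk : 2 / e1 < k%:R by apply: archi_boundP; rewrite divr_ge0// ltW.
have k0 : (0 < k)%N by rewrite -(ltr_nat R); apply: lt_trans hk; rewrite divr_gt0.
pose B := (N'`! * k)%N.
have B0 : (0 < B)%N by rewrite muln_gt0 fact_gt0.
have BR0 : 0 < B%:R :> R by rewrite ltr0n.
have hB : B%:R^-1 <= e1 / 2.
  rewrite -[e1 / 2]invrK lef_pV2 ?posrE ?invr_gt0 ?divr_gt0// invf_div.
  by apply: le_trans (ltW hk) _; rewrite ler_nat /B leq_pmull// fact_gt0.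
pose j := Num.truncn (lam * B%:R).
have /andP[j1 j2] : j%:R <= lam * B%:R < j.+1%:R by rewrite truncn_itv// mulr_ge0// ltW.
(* The midpoint between consecutive multiples of [1 / B] is at distance at least [1 / (2 B)] from
   all of them; the tolerance [e2] takes at most half of that. *)
pose lam' : R := (j%:R + 1 / 2) / B%:R.
have lB : lam' * B%:R = j%:R + 1 / 2 by rewrite /lam' divfK// gt_eqF.
have hl : `|lam' - lam| <= e1 / 2.
  apply: le_trans hB; rewrite -(ler_pM2r BR0) mulVf ?gt_eqF// -[X in _ * X](gtr0_norm BR0).
  rewrite -normrM mulrBl lB ler_norml; move: j2; rewrite -natr1 => j2.
  by apply/andP; split; lra.
have [hl1 hl2] : lam' - lam <= e1 / 2 /\ lam - lam' <= e1 / 2.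
  by move: hl; rewrite ler_norml => /andP[]; split; lra.
pose e2 : R := Num.min (e1 / 2) (4 * B%:R)^-1.
have e20 : 0 < e2 by rewrite lt_min divr_gt0//= invr_gt0 mulr_gt0.
have e2e1 : e2 <= e1 / 2 by rewrite /e2 ge_min lexx.
have e2B : e2 <= (4 * B%:R)^-1 by rewrite /e2 ge_min lexx orbT.
have e2e : e2 <= e by lra.
have l01 : 0 <= lam' <= 1.
  by apply/andP; split; lra.
have [_ /(_ y1 y2 Ky1 Ky2 e2 lam' e20 l01)] := lK.
move=> [p1 [p2 [q1 [q2 [p10 [p20 [q10 [q20 [z [Kz zq /andP[r1 r2]]]]]]]]]]].
move=> [pq1 qe1 z1] [pq2 qe2 z2].
set s := (p1 + p2)%N in r1 r2; have s0 : (0 < s)%N by rewrite addn_gt0 p10.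
have sR0 : 0 < s%:R :> R by rewrite ltr0n.
have sR0' : s%:R != 0 :> R by rewrite gt_eqF.
have Ns : (N' < s)%N.
  rewrite ltnNge; apply/negP => sN'.
  have /dvdnP[t tE] : (s %| B)%N by apply: dvdn_mulr; apply: dvdn_fact; rewrite s0.
  have BE : B%:R = t%:R * s%:R :> R by rewrite tE natrM.
  have cE : p1%:R / s%:R * B%:R = (p1 * t)%:R :> R by rewrite BE natrM; field.
  have e2B' : e2 * B%:R <= 1 / 4.
    apply: le_trans (ler_wpM2r (ltW BR0) e2B) _.
    by rewrite invfM -mulrA mulVf ?gt_eqF//; lra.
  have c1 : (p1 * t)%:R <= j%:R + 3 / 4 :> R.
    by rewrite -cE; apply: le_trans (ler_wpM2r (ltW BR0) r2) _; rewrite mulrDl lB; lra.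
  have c2 : j%:R + 1 / 4 <= (p1 * t)%:R :> R.
    by rewrite -cE; apply: le_trans (ler_wpM2r (ltW BR0) r1); rewrite mulrBl lB; lra.
  have [cj|jc] := leqP (p1 * t) j.
    by move: cj; rewrite -(ler_nat R); lra.
  by move: jc; rewrite -(ler_nat R) -natr1; lra.
have pE : p1%:R = p1%:R / s%:R * s%:R :> R by rewrite divfK.
exists p1, p2, q1, q2, z; split=> //.
- rewrite -(ler_nat R) pE.
  have h1 : lam / 2 <= p1%:R / s%:R by lra.
  apply: le_trans (ler_wpM2r (ltW sR0) h1); rewrite mulrC -ler_pdivrMr ?divr_gt0//.
  by apply: ltW; apply: lt_trans hN' _; rewrite ltr_nat.
- have le_e p : (1 + e2) * p%:R <= (1 + e) * p%:R by rewrite ler_wpM2r// lerD2l.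
  split=> //.
  + rewrite -/s {1}pE -mulrBl normrM (gtr0_norm sR0) ler_pM2r// ler_norml.
    by apply/andP; split; lra.
  + by split=> // [|i /z1 h]; [exact: le_trans (le_e _)|exact: lt_le_trans h e2e].
  + by split=> // [|i /z2 h]; [exact: le_trans (le_e _)|exact: lt_le_trans h e2e].
Qed.

End Orbits.
Lemma ler_normD5 (R : realDomainType) (a b c d f : R) :
  `|a + b + c + d + f| <= `|a| + `|b| + `|c| + `|d| + `|f|.
Proof. by do 4 (apply: le_trans (ler_normD _ _) _; rewrite lerD2r). Qed.

Lemma link_lengths p1 q1 p2 q2 : (p1 <= q1 -> 0 < p2 -> p2 <= q2 - q1 ->
  [/\ p1 + p2 <= q2, 0 < q2, minn q2 p1 = p1 & minn (q2 - q1) p2 = p2])%N.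
Proof. by move=> h1 h2 h3; split; lia. Qed.

Section Linking.
Variables (R : realType) (X : pointedType) (rho : X -> X -> R) (T : X -> X).
Variable K : set X.
Hypothesis lK : linkable rho T K.

Notation S := (@bsum _ (Borel rho) R T).
Notation avg := (@bavg _ (Borel rho) R T).

Variables (G : nat -> X -> R) (k : nat) (L M : R).
Hypothesis L0 : 0 <= L.
Hypothesis GL : forall i, (i < k)%N -> lipschitz_real rho L (G i).
Hypothesis GM : forall i y, (i < k)%N -> `|G i y| <= M.
Hypothesis M0 : 0 <= M.

Lemma link_average y1 y2 r1 r2 (lam eta : R) :
  K y1 -> iter r1 T y1 = y1 -> (0 < r1)%N ->
  K y2 -> iter r2 T y2 = y2 -> (0 < r2)%N -> 0 < lam < 1 -> 0 < eta ->
  exists z q, [/\ K z, iter q T z = z, (0 < q)%N & forall i, (i < k)%N ->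
    `|avg q (G i) z - (lam * avg r1 (G i) y1 + (1 - lam) * avg r2 (G i) y2)| <= eta].
Proof.
move=> Ky1 y1r r10 Ky2 y2r r20 lam01 eta0; have l0 := L0; have m0 := M0.
(* Per unit of time and of [e]: [L + M] for shadowing and gaps, [2 * M] for the error in the
   proportion, [M] for the difference between [q2] and [p1 + p2], and 1 for the incomplete periods
   collected in [A]. *)
pose C := L + 4 * M + 1; have C0 : 0 < C by rewrite /C; lra.
pose e := eta / C; have e0 : 0 < e by rewrite divr_gt0.
pose A := 2 * M * r1%:R + 2 * M * r2%:R.
have A0 : 0 <= A by rewrite /A addr_ge0// !mulr_ge0.
pose N := Num.bound (A / e).
have AN : A < e * N%:R.
  by rewrite mulrC -ltr_pdivrMr//; apply: archi_boundP; rewrite divr_ge0// ltW.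
have [p1 [p2 [q1 [q2 [z [Np1 p20 [Kz zq pl [pq1 qe1 z1] [pq2 qe2 z2]]]]]]]] :=
  link_large lK N Ky1 Ky2 e0 lam01.
have [pq q20 m1 m2] := link_lengths pq1 p20 pq2.
exists z, q2; split=> // i ik.
have := link_sum (ltW e0) L0 (GL ik) (fun y => GM y ik) pq1 qe1 z1 pq2 qe2 z2 (leqnn q2).
rewrite m1 m2 /=.
set s := (p1 + p2)%N; move=> [_ qs hS].
set a1 := avg r1 (G i) y1; set a2 := avg r2 (G i) y2.
have dev y r n : iter r T y = y -> (0 < r)%N ->
    `|S n (G i) y - n%:R * avg r (G i) y| <= 2 * M * r%:R.
  move=> yr r0; rewrite -[X in _ <= X]add0r -(mul0r n%:R).
  apply: periodic_dev => // [y'||]; first exact: GM.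
    by apply: bavg_bound => y'; exact: GM.
  by rewrite /bavg mulrA mulfV ?pnatr_eq0 -?lt0n// mul1r subrr normr0 mul0r.
have d1 := dev _ _ p1 y1r r10; have d2 := dev _ _ p2 y2r r20.
have aM y r : `|avg r (G i) y| <= M by apply: bavg_bound => y'; exact: GM.
have a1M := aM y1 r1; have a2M := aM y2 r2; rewrite -/a1 -/a2 in d1 d2 a1M a2M.
have sq : s%:R <= q2%:R :> R by rewrite ler_nat.
have q2R : 0 < q2%:R :> R by rewrite ltr0n.
set v := lam * a1 + (1 - lam) * a2.
have /andP[l1 l2] := lam01; have l3 : 0 < 1 - lam by lra.
have vM : `|v| <= M.
  apply: le_trans (ler_normD _ _) _; rewrite (normrM lam) (normrM (1 - lam)) (gtr0_norm l1) (gtr0_norm l3).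
  have := ler_wpM2l (ltW l1) a1M; have := ler_wpM2l (ltW l3) a2M; lra.
have -> : avg q2 (G i) z - v = q2%:R^-1 * (S q2 (G i) z - q2%:R * v).
  by rewrite mulrBr mulKf// gt_eqF.
rewrite normrM gtr0_norm ?invr_gt0// ler_pdivrMl//.
have -> : S q2 (G i) z - q2%:R * v = (S q2 (G i) z - (S p1 (G i) y1 + S p2 (G i) y2))
   + (S p1 (G i) y1 - p1%:R * a1) + (S p2 (G i) y2 - p2%:R * a2)
   + (p1%:R - lam * s%:R) * (a1 - a2) + (s%:R - q2%:R) * v.
  by rewrite /v /s natrD; ring.
have h4 : `|(p1%:R - lam * s%:R) * (a1 - a2)| <= e * s%:R * (2 * M).
  rewrite normrM; apply: ler_pM => //; apply: le_trans (ler_normB _ _) _; lra.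
have h5 : `|(s%:R - q2%:R) * v| <= e * s%:R * M.
  rewrite normrM; apply: ler_pM => //; rewrite distrC ger0_norm; lra.
have sp : e * N%:R <= e * s%:R.
  by rewrite ler_pM2l// ler_nat (leq_trans Np1) ?leq_addr.
have eC : e * C = eta by rewrite /e divfK// gt_eqF.
have es : e * s%:R * C <= q2%:R * eta.
  by rewrite -eC mulrA [q2%:R * e]mulrC ler_pM2r// ler_pM2l.
apply: le_trans (ler_normD5 _ _ _ _ _) _.
move: AN hS d1 d2 h4 h5 sp es; rewrite /A /C => AN hS d1 d2 h4 h5 sp es.
lra.
Qed.

(** The old orbit takes about the proportion [lam] of the new period, so the whole period deviates
    by at most [2 * eta] however bad [w] is. After time [P] both pieces deviate by at most [d] up to
    errors that fit into [eta]. The bound [d] is left free so that the next stage can insert the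
    deviation of the current one. *)
Lemma link_step (m : nat -> R) w q z r (eta : R) N :
  (forall i, (i < k)%N -> `|m i| <= M) ->
  K w -> iter q T w = w -> (0 < q)%N -> K z -> iter r T z = z -> (0 < r)%N -> 0 < eta ->
  (forall i, (i < k)%N -> `|S r (G i) z - r%:R * m i| <= eta * r%:R) ->
  exists w' q' P, [/\ [/\ K w', iter q' T w' = w' & (0 < q')%N], (N <= P)%N,
    bowen_ball rho T w P eta w' &
    forall i, (i < k)%N ->
      `|S q' (G i) w' - q'%:R * m i| <= 2 * eta * q'%:R /\
      forall d, eta <= d -> `|S q (G i) w - q%:R * m i| <= d * q%:R ->
        forall n, (P <= n)%N -> `|S n (G i) w' - n%:R * m i| <= (d + eta) * n%:R].
Proof.
move=> mM Kw wq q0 Kz zr r0 eta0 hz; have l0 := L0; have m0 := M0.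
(* With [e * C = eta / 2] the linking errors fit into [eta / 2]; the choice of [lam] leaves the
   other half for the time spent along [w]. *)
pose C := L + 4 * M + 2; have C2 : 2 <= C by rewrite /C; lra.
pose e := eta / (2 * C); have e0 : 0 < e by rewrite divr_gt0//; lra.
have eC : e * (2 * C) = eta by rewrite /e divfK// gt_eqF//; lra.
have ee : e <= eta by nra.
pose lam := Num.min (1 / 2) (eta / (4 * (M + 1))).
have lam01 : 0 < lam < 1.
  by rewrite lt_min gt_min !divr_gt0//=; [apply/orP; left; lra|lra].
have lamM : 2 * M * lam <= eta / 2.
  apply: (@le_trans _ _ (2 * M * (eta / (4 * (M + 1))))).
    by rewrite ler_wpM2l ?mulr_ge0// ge_min lexx orbT.
  rewrite mulrA ler_pdivrMr; last by lra.
  by have := mulr_ge0 m0 (ltW eta0); lra.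
pose A := 2 * M * q%:R + 2 * M * r%:R.
have A0 : 0 <= A by rewrite /A addr_ge0// !mulr_ge0.
pose N' := maxn N (Num.bound (A / e)).
have AN : A <= e * N'%:R.
  rewrite mulrC -ler_pdivrMr//.
  apply: le_trans (ltW (archi_boundP _)) _; first by rewrite divr_ge0// ltW.
  by rewrite ler_nat leq_maxr.
have [p1 [p2 [q1 [q2 [z' [Np1 p20 [Kz' zq pl [pq1 qe1 z1] [pq2 qe2 z2]]]]]]]] :=
  link_large lK N' Kw Kz e0 lam01.
have [pq q20 m1 m2] := link_lengths pq1 p20 pq2.
have Ap1 : A <= e * p1%:R.
  by apply: le_trans AN _; rewrite ler_pM2l// ler_nat.
exists z', q2, p1; split=> //.
- exact: leq_trans (leq_maxl _ _) Np1.
- by move=> j /z1 h; exact: lt_le_trans h ee.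
move=> i ik; have mMi := mM i ik.
have piece n : (n <= q2)%N -> let a := minn n p1 in let c := minn (n - q1) p2 in
    (a + c <= n)%N /\ `|S n (G i) z' - n%:R * m i| <= `|S a (G i) w - a%:R * m i|
      + `|S c (G i) z - c%:R * m i| + (L + 2 * M) * (e * n%:R).
  move=> nq a c.
  have [acn nac hS] := link_sum (ltW e0) L0 (GL ik) (fun y => GM y ik) pq1 qe1 z1 pq2 qe2 z2 nq.
  split=> //.
  have -> : S n (G i) z' - n%:R * m i = (S a (G i) w - a%:R * m i)
      + (S c (G i) z - c%:R * m i) + (S n (G i) z' - (S a (G i) w + S c (G i) z))
      + (a%:R + c%:R - n%:R) * m i + 0 by ring.
  apply: le_trans (ler_normD5 _ _ _ _ _) _; rewrite normr0 addr0.
  have acR : (a + c)%:R <= n%:R :> R by rewrite ler_nat.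
  have eac : e * (a + c)%:R <= e * n%:R by rewrite ler_pM2l.
  have h1 : (L + M) * e * (a + c)%:R <= (L + M) * (e * n%:R).
    by rewrite -mulrA ler_wpM2l// addr_ge0.
  have h2 : `|(a%:R + c%:R - n%:R) * m i| <= e * n%:R * M.
    rewrite normrM; apply: ler_pM => //; rewrite -natrD distrC ger0_norm; last by lra.
    by apply: le_trans eac; lra.
  lra.
have SM y n : `|S n (G i) y - n%:R * m i| <= 2 * M * n%:R.
  apply: le_trans (ler_normB _ _) _.
  have h1 := @bsum_bound _ (Borel rho) R T n (G i) y M (fun y => GM y ik).
  have h2 : `|n%:R * m i| <= n%:R * M by rewrite normrM ger0_norm// ler_wpM2l.
  lra.
have devz n := periodic_dev n zr r0 (fun y => GM y ik) mMi (hz i ik).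
have eq2 : e * p1%:R <= e * q2%:R.
  by rewrite ler_pM2l// ler_nat (leq_trans _ pq) ?leq_addr.
split.
  have [_] := piece q2 (leqnn q2); rewrite m1 m2 => h.
  have hp2 : eta * p2%:R <= eta * q2%:R.
    by rewrite ler_pM2l// ler_nat (leq_trans _ pq) ?leq_addl.
  have h1 := SM w p1; have h2 := devz p2.
  have hp1 : p1%:R <= (lam + e) * q2%:R.
    apply: (@le_trans _ _ ((lam + e) * (p1 + p2)%:R)).
      by move: pl; rewrite ler_norml => /andP[_]; lra.
    have /andP[? _] := lam01.
    by rewrite ler_wpM2l ?ler_nat//; lra.
  have h3 : 2 * M * p1%:R <= 2 * M * ((lam + e) * q2%:R) by rewrite ler_wpM2l// mulr_ge0.
  have h4 : 2 * M * lam * q2%:R <= eta / 2 * q2%:R by rewrite ler_wpM2r.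
  have h5 : 2 * M * r%:R <= e * q2%:R.
    by apply: le_trans (le_trans Ap1 eq2); rewrite /A lerDr !mulr_ge0.
  have h6 : eta * q2%:R = 2 * C * (e * q2%:R) by rewrite -eC; ring.
  have h7 := mulr_ge0 (ltW e0) (ler0n R q2).
  by rewrite /C in h6; lra.
move=> d etad hd n pn.
have devw n' := periodic_dev n' wq q0 (fun y => GM y ik) mMi hd.
have d0 : 0 <= d by lra.
have piece' n' : (n' <= q2)%N -> `|S n' (G i) z' - n'%:R * m i| <=
    (d + (L + 2 * M) * e) * n'%:R + A.
  move=> nq; have [ac h] := piece n' nq; apply: le_trans h _.
  have h1 := devw (minn n' p1); have h2 := devz (minn (n' - q1) p2).
  have h3 : eta * (minn (n' - q1) p2)%:R <= d * (minn (n' - q1) p2)%:R by rewrite ler_wpM2r.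
  have h4 : d * (minn n' p1)%:R + d * (minn (n' - q1) p2)%:R <= d * n'%:R.
    by rewrite -mulrDr -natrD ler_wpM2l// ler_nat.
  by rewrite /A; lra.
set t := (n %/ q2)%N; set s := (n %% q2)%N.
have nE : n = (t * q2 + s)%N by exact: divn_eq.
have sq : (s <= q2)%N by rewrite ltnW// ltn_mod.
have nR : n%:R = t%:R * q2%:R + s%:R :> R by rewrite [in LHS]nE natrD natrM.
have -> : S n (G i) z' - n%:R * m i =
    t%:R * (S q2 (G i) z' - q2%:R * m i) + (S s (G i) z' - s%:R * m i).
  rewrite nR [in LHS]nE bsum_add bsum_periodic// iter_periodic//; ring.
apply: le_trans (ler_normD _ _) _; rewrite normrM (ger0_norm (ler0n _ t)).
have h1 := ler_wpM2l (ler0n R t) (piece' q2 (leqnn q2)); have h2 := piece' s sq.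
(* Each of the [t] full periods and the incomplete one costs [A], which is at most [e * p1]; when
   [t = 0] the assumption that [n] is at least [p1] pays. *)
have tA : (t%:R + 1) * A <= 2 * (e * n%:R).
  have enp : e * p1%:R <= e * n%:R by rewrite ler_pM2l// ler_nat.
  have [t0|t0] := posnP t; first by rewrite t0; nra.
  have t1 : 1 <= t%:R :> R by rewrite ler1n.
  have h3 : t%:R * A <= t%:R * (e * q2%:R) by rewrite ler_wpM2l// (le_trans Ap1).
  have h4 : e * (t%:R * q2%:R) <= e * n%:R by rewrite ler_pM2l// nR lerDl.
  have h5 : A <= t%:R * A by rewrite ler_peMl.
  by lra.
have h6 : eta * n%:R = 2 * C * (e * n%:R) by rewrite -eC; ring.
have h7 := mulr_ge0 (ltW e0) (ler0n R n).
have h8 := mulr_ge0 l0 h7; have h9 := mulr_ge0 m0 h7.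
have -> : (d + eta) * n%:R = d * n%:R + eta * n%:R by ring.
rewrite h6 /C.
move: h1 h2; rewrite nR in tA h7 h8 h9 *.
by lra.
Qed.

End Linking.
(** * Approximation of invariant measures by periodic orbits *)

Section Approximation.
Variables (R : realType) (X : pointedType) (rho : X -> X -> R) (T : X -> X).
Hypotheses (rhoM : is_metric rho) (rhoX : rho_complete rho) (rhoS : rho_separable rho).
Hypothesis cT : rho_continuous rho T.
Variable K : set X.
Hypotheses (lK : linkable rho T K) (cK : K_closeable rho T K).

Notation S := (@bsum _ (Borel rho) R T).
Notation avg := (@bavg _ (Borel rho) R T).

Lemma lipschitz_continuous_real L g : lipschitz_real rho L g -> rho_continuous_real rho g.
Proof.
move=> Lg x e e0; pose L' := `|L| + 1.
have L'0 : 0 < L' by rewrite /L'; have := normr_ge0 L; lra.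
exists (e / L'); first by rewrite divr_gt0.
move=> y xy; apply: le_lt_trans (Lg x y) _.
apply: (@le_lt_trans _ _ (L' * rho x y)); last by rewrite mulrC -ltr_pdivlMr.
by rewrite ler_wpM2r ?rho_ge0// /L'; have := ler_norm L; lra.
Qed.

Lemma continuous_bmeas f M : rho_continuous_real rho f -> (forall y, `|f y| <= M) ->
  @bmeas _ (Borel rho) R f.
Proof.
move=> cf fM; split; last by exists M.
apply: (measurability _ (RGenOInfty.measurableE R)) => //.
move=> _ [_ [r ->] <-]; apply: measurable_open; rewrite setTI.
move=> x /=; rewrite in_itv /= andbT => rx.
have [|d d0 fd] := cf x (f x - r); first by rewrite subr_gt0.
by exists d => // y /fd /=; rewrite in_itv /= andbT ltr_norml => /andP[]; lra.
Qed.

Lemma generic_cvg (nu : probability (Borel rho) R) x f M : generic rho T nu x ->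
  rho_continuous_real rho f -> (forall y, `|f y| <= M) ->
  (avg n f x) @[n --> \oo] --> \int[nu]_y f y.
Proof.
move=> gx cf fM; have := gx f cf (ex_intro _ M fM).
rewrite (EFin_Rintegral nu (continuous_bmeas cf fM)).
by move/fine_cvgP => [_].
Qed.

Lemma ergodic_periodic (nu : probability (Borel rho) R) f L M (e : R) :
  ergodic rho T nu -> 0 <= L -> lipschitz_real rho L f -> (forall y, `|f y| <= M) -> 0 < e ->
  exists z q, [/\ K z, iter q T z = z, (0 < q)%N & `|avg q f z - \int[nu]_y f y| <= e].
Proof.
move=> erg L0 Lf fM e0; have [x [gx cx]] := cK erg.
have M0 : 0 <= M by exact: le_trans (fM x).
have cf := lipschitz_continuous_real Lf; have bf := continuous_bmeas cf fM.
set a := \int[nu]_y f y.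
have aM : `|a| <= M.
  rewrite -[a]subr0 -(Rint_cst nu 0); apply: Rint_dist => //; first exact: bmeas_cst.
  by move=> y; rewrite subr0.
have e20 : 0 < e / 2 by rewrite divr_gt0.
have /cvgnP/(_ _ e20)[N hN] := generic_cvg gx cf fM; rewrite -/a in hN.
(* [L] pays for shadowing during [p] steps, and [2 * M] for the at most [e' * p] steps that remain
   until the period [q]. *)
pose C := L + 2 * M + 1; have C0 : 0 < C by rewrite /C; lra.
pose e' := e / 2 / C; have e'0 : 0 < e' by rewrite divr_gt0.
have e'C : e' * C = e / 2 by rewrite /e' divfK// gt_eqF.
have [p [q [Np pq qe [y [xy Ky yq]]]]] := cx e' N.+1 e'0 (ltn0Sn N).
have p0 : (0 < p)%N by exact: leq_trans Np.
have q0 : (0 < q)%N by exact: leq_trans pq.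
have pR0 : 0 < p%:R :> R by rewrite ltr0n.
have qR0 : 0 < q%:R :> R by rewrite ltr0n.
exists y, q; split=> //.
have -> : avg q f y - a = q%:R^-1 * (S q f y - q%:R * a).
  by rewrite mulrBr mulKf// gt_eqF.
rewrite normrM gtr0_norm ?invr_gt0// ler_pdivrMl//.
have Sq : S q f y = S p f y + S (q - p) f (iter p T y).
  by rewrite -{1}(subnKC pq) bsum_add.
have h1 := bsum_shadow L0 Lf (leqnn p) xy.
have h2 : `|S p f x - p%:R * a| <= e / 2 * p%:R.
  have -> : S p f x - p%:R * a = (avg p f x - a) * p%:R.
    by rewrite /bavg mulrBl mulrAC mulVf ?mul1r ?gt_eqF// mulrC.
  rewrite normrM (gtr0_norm pR0) ler_pM2r//; apply/ltW/hN; exact: ltnW.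
have h3 := @bsum_bound _ (Borel rho) R T (q - p) f (iter p T y) M fM.
have qpR : (q - p)%:R = q%:R - p%:R :> R by rewrite natrB.
have h4 : `|(q - p)%:R * a| <= (q - p)%:R * M by rewrite normrM ger0_norm// ler_wpM2l.
have h5 : (q - p)%:R * M <= e' * p%:R * M by rewrite ler_wpM2r// qpR; lra.
have -> : S q f y - q%:R * a = (S p f y - S p f x) + (S p f x - p%:R * a)
    + S (q - p) f (iter p T y) + - ((q - p)%:R * a) + 0.
  by rewrite Sq qpR; ring.
apply: le_trans (ler_normD5 _ _ _ _ _) _; rewrite normrN normr0 addr0.
have h6 : e * p%:R <= e * q%:R by rewrite ler_pM2l// ler_nat.
have h7 : e / 2 * p%:R = e' * p%:R * C by rewrite -e'C; ring.
have h8 : 0 <= e' * p%:R by rewrite mulr_ge0// ltW.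
rewrite [q%:R * e]mulrC; rewrite /C in h7.
by clear -h1 h2 h3 h4 h5 h6 h7 h8; lra.
Qed.

(** It makes the infimum in [K_periodic_dense] range over a nonempty set. The zero function serves
    to extract some ergodic measure, and closeability then gives the orbit. *)
Lemma exists_K_periodic (mu : probability (Borel rho) R) : invariant_prob rho T mu ->
  exists z q, [/\ K z, iter q T z = z & (0 < q)%N].
Proof.
move=> muT.
have [nu erg _] := bounded_ergodic_ge rhoM rhoX rhoS cT muT (bmeas_cst 0) ltr01.
have [|y||z [q [Kz zq q0 _]]] := @ergodic_periodic nu (fun=> 0) 0 0 1 erg (lexx 0).
- by move=> x y; rewrite subrr normr0 mul0r.
- by rewrite normr0.
- exact: ltr01.
- by exists z, q.
Qed.

Variables (G : nat -> X -> R) (k : nat) (L M : R).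
Hypothesis L0 : 0 <= L.
Hypothesis GL : forall i, (i < k)%N -> lipschitz_real rho L (G i).
Hypothesis GM : forall i y, (i < k)%N -> `|G i y| <= M.
Hypothesis M0 : 0 <= M.
Variable mu : probability (Borel rho) R.
Hypothesis muT : invariant_prob rho T mu.

(* Minimise the distance from the vector of [mu]-integrals [m] to the averages along
   periodic orbits in [K]. Averages along some orbit in [K] lie beyond the hyperplane
   through [m] orthogonal to [m - v], and linking moves [v] towards them. *)
Lemma K_periodic_dense (e : R) : 0 < e ->
  exists z q, [/\ K z, iter q T z = z, (0 < q)%N & forall i, (i < k)%N ->
    `|avg q (G i) z - \int[mu]_y G i y| <= e].
Proof.
move=> e0; have l0 := L0; have m0 := M0.
have bG (i : 'I_k) : @bmeas _ (Borel rho) R (G i).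
  by apply: (continuous_bmeas (M := M)) => [|y]; [exact/lipschitz_continuous_real/GL|exact: GM].
pose m (i : 'I_k) := \int[mu]_y G i y.
have mM i : `|m i| <= M.
  rewrite -[m i]subr0 -(Rint_cst mu 0); apply: Rint_dist => //; first exact: bmeas_cst.
  by move=> y; rewrite subr0 GM.
have aM z q (i : 'I_k) : `|avg q (G i) z| <= M by apply: bavg_bound => y; exact: GM.
pose D z q := \sum_(i < k) (m i - avg q (G i) z) ^+ 2.
pose E := [set r | exists z q, [/\ K z, iter q T z = z, (0 < q)%N & r = D z q]].
have [z0 [q0 [Kz0 zq0 q00]]] := exists_K_periodic muT.
have E0 : E !=set0 by exists (D z0 q0), z0, q0.
have D0 z q : 0 <= D z q by apply: sumr_ge0 => i _; exact: sqr_ge0.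
have Elb : has_lbound E by exists 0 => _ [z [q [_ _ _ ->]]].
pose d := inf E.
have dE z q : K z -> iter q T z = z -> (0 < q)%N -> d <= D z q.
  by move=> *; apply: ge_inf => //; exists z, q.
have d0 : 0 <= d by apply: lb_le_inf => // _ [z [q [_ _ _ ->]]].
have [dle|dgt] := leP d 0.
  have [|_ [z [q [Kz zq q_gt0 ->]]] Dz] := @inf_lt _ E (e ^+ 2) E0.
    by apply: le_lt_trans dle _; rewrite exprn_gt0.
  exists z, q; split=> // i ik.
  rewrite distrC -(ler_pXn2r (n := 2)) ?nnegrE ?(ltW e0)//.
  rewrite real_normK ?num_real//; apply: le_trans (ltW Dz).
  rewrite /D (bigD1 (Ordinal ik)) //= lerDl; apply: sumr_ge0 => j _; exact: sqr_ge0.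
(* The constants fit the expansion of the squared distance after a step [lam]: it is below [d + del
   - 2 * lam * d + 4 * lam * del + lam * d / 2 + lam * d / 8], which is less than [d] for
   [del = lam * d / 8]. The 1 added in [B] and in [H] keeps these divisors positive. *)
pose B : R := k%:R * (4 * M ^+ 2) + 1.
have B0 : 0 < B by rewrite /B ltr_wpDl// !mulr_ge0// sqr_ge0.
pose lam := Num.min (1 / 2) (d / (2 * B)).
have lam0 : 0 < lam by rewrite lt_min !divr_gt0//= mulr_gt0.
have lam2 : lam <= 1 / 2 by rewrite ge_min lexx.
have lamB : lam * B <= d / 2.
  have : lam <= d / (2 * B) by rewrite ge_min lexx orbT.
  by rewrite ler_pdivlMr ?mulr_gt0//; lra.
pose del := lam * d / 8; have del0 : 0 < del by rewrite !mulr_gt0.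
pose H : R := 4 * k%:R * M + 1.
have H0 : 0 < H by rewrite /H ltr_wpDl// !mulr_ge0.
pose eta := lam * d / 8 / H; have eta0 : 0 < eta by rewrite divr_gt0.
have etaH : eta * H = lam * d / 8 by rewrite /eta divfK// gt_eqF.
have [|_ [v [qv [Kv vq qv0 ->]]] Dv] := @inf_lt _ E (d + del) E0; first by rewrite -/d; lra.
(* [c] points from the averages of [v] to [m], and [f] is the linear functional that it defines. *)
pose c (i : 'I_k) := m i - avg qv (G i) v.
pose f y := \sum_(i < k) c i * G i y.
have [nu erg hnu] : exists2 nu : probability (Borel rho) R, ergodic rho T nu &
    \int[mu]_y f y - del < \int[nu]_y f y.
  apply: bounded_ergodic_ge => //; apply: bmeas_sum => i; exact: bmeasZ.
pose Lf := \sum_(i < k) `|c i| * L; pose Mf := \sum_(i < k) `|c i| * M.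
have Lf0 : 0 <= Lf by apply: sumr_ge0 => i _; rewrite mulr_ge0.
have Lff : lipschitz_real rho Lf f.
  move=> x y; rewrite /f -sumrB /Lf mulr_suml.
  apply: le_trans (ler_norm_sum _ _ _) _; apply: ler_sum => i _.
  by rewrite -mulrBr normrM -mulrA ler_wpM2l//; exact: GL.
have fMf y : `|f y| <= Mf.
  apply: le_trans (ler_norm_sum _ _ _) _; apply: ler_sum => i _.
  by rewrite normrM ler_wpM2l// GM.
have [w [qw [Kw wq qw0 hw]]] := ergodic_periodic erg Lf0 Lff fMf del0.
have fmu : \int[mu]_y f y = \sum_(i < k) c i * m i.
  rewrite Rint_sum => [|i]; last exact: bmeasZ.
  by apply: eq_bigr => i _; rewrite RintZ.
have fw : avg qw f w = \sum_(i < k) c i * avg qw (G i) w.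
  rewrite /bavg /bsum exchange_big mulr_sumr; apply: eq_bigr => i _ /=.
  by rewrite -mulr_sumr mulrCA.
pose dl (i : 'I_k) := avg qw (G i) w - avg qv (G i) v.
(* One [del] is lost in passing from [mu] to the ergodic [nu], the other from [nu] to the orbit of
   [w]. *)
have cw : D v qv - 2 * del <= \sum_(i < k) c i * dl i.
  have -> : \sum_(i < k) c i * dl i = avg qw f w - \int[mu]_y f y + D v qv.
    rewrite fw fmu /D -sumrB -big_split /=; apply: eq_bigr => i _.
    by rewrite /dl /c expr2; ring.
  by move: hw; rewrite ler_norml => /andP[h _]; lra.
have lam01 : 0 < lam < 1 by rewrite lam0/=; lra.
have [u [qu [Ku uq qu0 hu]]] :=
  link_average lK L0 GL GM M0 Kw wq qw0 Kv vq qv0 lam01 eta0.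
have Du : D u qu <= \sum_(i < k) ((c i - lam * dl i) ^+ 2 + 4 * M * eta).
  apply: ler_sum => i _; have hui := hu i (ltn_ord i).
  set x := m i - avg qu (G i) u; set y := c i - lam * dl i.
  have xy : `|x - y| <= eta.
    rewrite distrC (_ : y - x = avg qu (G i) u - (lam * avg qw (G i) w + (1 - lam) * avg qv (G i) v)) //.
    by rewrite /x /y /c /dl; ring.
  have xM : `|x| <= 2 * M.
    by apply: le_trans (ler_normB _ _) _; have := mM i; have := aM u qu i; lra.
  have yM : `|y| <= 2 * M.
    have -> : y = lam * (m i - avg qw (G i) w) + (1 - lam) * (m i - avg qv (G i) v).
      by rewrite /y /c /dl; ring.
    have l1 : 0 <= 1 - lam by lra.
    apply: le_trans (ler_normD _ _) _.
    rewrite (normrM lam) (normrM (1 - lam)) (gtr0_norm lam0) (ger0_norm l1).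
    have h1 : `|m i - avg qw (G i) w| <= 2 * M.
      by apply: le_trans (ler_normB _ _) _; have := mM i; have := aM w qw i; lra.
    have h2 : `|m i - avg qv (G i) v| <= 2 * M.
      by apply: le_trans (ler_normB _ _) _; have := mM i; have := aM v qv i; lra.
    by have := ler_wpM2l (ltW lam0) h1; have := ler_wpM2l l1 h2; lra.
  have -> : x ^+ 2 = y ^+ 2 + (x - y) * (x + y) by ring.
  rewrite lerD2l; apply: le_trans (ler_norm _) _; rewrite normrM [4 * M * eta]mulrC.
  by apply: ler_pM => //; apply: le_trans (ler_normD _ _) _; lra.
have sq : \sum_(i < k) ((c i - lam * dl i) ^+ 2 + 4 * M * eta) =
    D v qv - 2 * lam * (\sum_(i < k) c i * dl i) + lam ^+ 2 * (\sum_(i < k) dl i ^+ 2)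
    + 4 * k%:R * M * eta.
  rewrite big_split /= sumr_const card_ord -[(4 * M * eta) *+ k]mulr_natr.
  rewrite (eq_bigr (fun i => c i ^+ 2 - 2 * lam * (c i * dl i) + lam ^+ 2 * dl i ^+ 2)).
    by rewrite big_split /= sumrB -!mulr_sumr /D; ring.
  by move=> i _; ring.
have dlB : \sum_(i < k) dl i ^+ 2 <= B.
  apply: (@le_trans _ _ (\sum_(i < k) 4 * M ^+ 2)).
    apply: ler_sum => i _; rewrite (_ : 4 * M ^+ 2 = (2 * M) ^+ 2); last by ring.
    rewrite -[dl i ^+ 2]real_normK ?num_real// ler_pXn2r ?nnegrE ?mulr_ge0//.
    by apply: le_trans (ler_normB _ _) _; have := aM w qw i; have := aM v qv i; lra.
  by rewrite sumr_const card_ord -[_ *+ k]mulr_natl /B lerDl.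
have := dE u qu Ku uq qu0; rewrite leNgt => /negP; case.
apply: le_lt_trans Du _; rewrite sq.
have h1 : lam ^+ 2 * (\sum_(i < k) dl i ^+ 2) <= lam * (d / 2).
  rewrite expr2 -mulrA ler_pM2l//; apply: le_trans lamB; by rewrite ler_pM2l.
have h2 : lam * (D v qv - 2 * del) <= lam * (\sum_(i < k) c i * dl i) by rewrite ler_pM2l.
have h3 : lam * d <= lam * D v qv by rewrite ler_pM2l//; exact: dE.
have h4 : lam * del <= 1 / 2 * del by rewrite ler_pM2r.
have h5 : 4 * k%:R * M * eta <= lam * d / 8.
  by rewrite -etaH /H; lra.
have h6 : 0 < lam * d by rewrite mulr_gt0.
move: Dv h1 h2 h3 h4 h5 h6; rewrite /del.
move: (D v qv) (\sum_(i < k) c i * dl i) (lam ^+ 2 * _) (4 * k%:R * M * eta) => D1 s1 s2 s3.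
by clear; move=> Dv h1 h2 h3 h4 h5 h6; lra.
Qed.

End Approximation.
(** * A countable determining class *)

Section Determining.
Variables (R : realType) (X : pointedType) (rho : X -> X -> R) (T : X -> X).
Hypothesis rhoM : is_metric rho.

Notation avg := (@bavg _ (Borel rho) R T).

Definition bounded_lipschitz (g : X -> R) :=
  exists L M, [/\ 0 <= L, lipschitz_real rho L g & forall y, `|g y| <= M].

Lemma bounded_lipschitz_cst (c : R) : bounded_lipschitz (fun=> c).
Proof. by exists 0, `|c|; split=> // x y; rewrite subrr normr0 mul0r. Qed.

Lemma ler_dist_max (a b a' b' : R) :
  `|Num.max a b - Num.max a' b'| <= `|a - a'| + `|b - b'|.
Proof.
have h1 := ler_norm (a - a'); have h2 := ler_norm (b - b').
have h3 := ler_norm (a' - a); have h4 := ler_norm (b' - b).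
rewrite (distrC a' a) in h3; rewrite (distrC b' b) in h4.
have h5 := normr_ge0 (a - a'); have h6 := normr_ge0 (b - b').
rewrite ler_norml.
by case: (leP a b) => ab; case: (leP a' b') => ab'; apply/andP; split; lra.
Qed.

Lemma bounded_lipschitz_max f g : bounded_lipschitz f -> bounded_lipschitz g ->
  bounded_lipschitz (fun y => Num.max (f y) (g y)).
Proof.
move=> [L [M [L0 Lf fM]]] [L' [M' [L'0 Lg gM]]].
exists (L + L'), (Num.max M M'); split=> [|x y|y]; first exact: addr_ge0.
  apply: le_trans (ler_dist_max _ _ _ _) _; rewrite mulrDl; exact: lerD.
by have [fg|gf] := leP (f y) (g y); rewrite le_max ?gM ?fM ?orbT.
Qed.

Definition cone (x : X) (v s : R) (y : X) : R := Num.max 0 (v - s * rho x y).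

Lemma bounded_lipschitz_cone x v s : 0 <= v -> 0 <= s -> bounded_lipschitz (cone x v s).
Proof.
move=> v0 s0; exists s, v; split=> // [y z|y].
  apply: le_trans (ler_dist_max _ _ _ _) _; rewrite subrr normr0 add0r.
  have -> : v - s * rho x y - (v - s * rho x z) = s * (rho x z - rho x y) by ring.
  rewrite normrM (ger0_norm s0) ler_wpM2l// ler_norml.
  have := rho_triangle rhoM x y z; have := rho_triangle rhoM x z y.
  by rewrite (rhoC rhoM z y) => h1 h2; apply/andP; split; lra.
rewrite ger0_norm /cone ?le_max ?lexx// ge_max v0 /=.
by rewrite lerBlDr lerDl mulr_ge0// rho_ge0.
Qed.

Variable D : nat -> X.
Hypothesis dD : forall x (e : R), 0 < e -> exists i, rho (D i) x < e.

Definition rational_cone (j : nat) : X -> R :=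
  if unpickle j is Some (i, a, b, s) then cone (D i) (a%:R / b.+1%:R) s%:R else fun=> 0.

Fixpoint max_cones (l : seq nat) (y : X) : R :=
  if l is j :: l' then Num.max (rational_cone j y) (max_cones l' y) else 0.

(** A countable class that approximates every nonnegative bounded continuous function pointwise from
    below. This bounds lower limits of averages from below, and the same bound for the opposite
    function gives convergence. *)
Definition test_function (n : nat) : X -> R :=
  max_cones (if unpickle n is Some l then l else [::]).

Lemma bounded_lipschitz_test n : bounded_lipschitz (test_function n).
Proof.
suff H l : bounded_lipschitz (max_cones l) by exact: H.
elim: l => [|j l IH] /=; first exact: bounded_lipschitz_cst.
apply: bounded_lipschitz_max => //; rewrite /rational_cone.
case: unpickle => [[[[i a] b] s]|]; last exact: bounded_lipschitz_cst.
by apply: bounded_lipschitz_cone => //; rewrite divr_ge0.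
Qed.

(** Three losses of [eta / 3]: the oscillation of [f] near [x], the rounding of the height, and the
    distance from the centre of the cone to [x]. The slope makes the cone vanish at distance [d]
    from [x], where nothing but [0 <= f] is known. *)
Lemma rational_cone_approx f x (eta : R) : rho_continuous_real rho f ->
  (forall y, 0 <= f y) -> 0 < eta ->
  exists2 j, forall y, rational_cone j y <= f y & f x - eta < rational_cone j x.
Proof.
move=> cf f0 eta0; have [fx|fx] := ltP (f x) eta.
  exists (pickle (0, 0, 0, 0)%N) => [y|]; rewrite /rational_cone pickleK /cone mul0r mul0r subrr maxxx//.
  by lra.
have e30 : 0 < eta / 3 by rewrite divr_gt0.
have [d d0 fd] := cf x _ e30.
pose b := Num.bound (3 / eta).
have hb : 3 / eta < b.+1%:R.
  by apply: lt_trans (archi_boundP _) _; [rewrite divr_ge0// ltW|rewrite ltr_nat].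
have bR0 : 0 < b.+1%:R :> R by [].
have hb' : b.+1%:R^-1 < eta / 3.
  by rewrite -[eta / 3]invrK ltf_pV2 ?posrE ?invr_gt0 ?invf_div.
pose a := Num.truncn ((f x - eta / 3) * b.+1%:R).
have /andP[a1 a2] : a%:R <= (f x - eta / 3) * b.+1%:R < a.+1%:R.
  by rewrite truncn_itv// mulr_ge0//; lra.
pose v : R := a%:R / b.+1%:R.
have v1 : v <= f x - eta / 3 by rewrite /v ler_pdivrMr.
have v2 : f x - eta / 3 - b.+1%:R^-1 < v.
  have vE : v + b.+1%:R^-1 = a.+1%:R / b.+1%:R by rewrite -(natr1 a) mulrDl mul1r.
  by rewrite ltrBlDr vE ltr_pdivlMr.
have v0 : 0 <= v by rewrite /v divr_ge0.
pose s := (Num.bound (2 * v / d)).+1.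
have hs : 2 * v / d < s%:R.
  by apply: lt_trans (archi_boundP _) _; [rewrite divr_ge0 ?mulr_ge0// ltW|rewrite ltr_nat].
have sR0 : 0 < s%:R :> R by [].
have [|i xi] := dD x (e := Num.min (d / 2) (eta / 3 / s%:R)).
  by rewrite lt_min !divr_gt0.
move: xi; rewrite lt_min => /andP[xi1 xi2].
exists (pickle (i, a, b, s)) => [y|]; rewrite /rational_cone pickleK /cone.
  rewrite ge_max f0 /=; have [yd|dy] := ltP (rho x y) d.
    have := fd y yd; rewrite ltr_norml => /andP[_ h].
    have := mulr_ge0 (ltW sR0) (rho_ge0 rhoM (D i) y); rewrite -/v; lra.
  apply: le_trans (f0 y); rewrite subr_le0 -/v.
  have hd : d / 2 <= rho (D i) y.
    by have := rho_triangle rhoM x (D i) y; rewrite (rhoC rhoM x (D i)); lra.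
  apply: le_trans (ler_wpM2l (ltW sR0) hd).
  by move: hs; rewrite ltr_pdivrMr//; lra.
rewrite lt_max -/v; apply/orP; right.
by move: xi2; rewrite ltr_pdivlMr// mulrC; move: (_ ^-1) hb' v2 => r; lra.
Qed.

Variable mu : probability (Borel rho) R.
Variable w : X.
Hypothesis tw : forall n,
  (avg N (test_function n) w) @[N --> \oo] --> \int[mu]_y test_function n y.

Let bt n : @bmeas _ (Borel rho) R (test_function n).
Proof.
have [L [M [L0 Lg gM]]] := bounded_lipschitz_test n.
exact: continuous_bmeas (lipschitz_continuous_real rhoM Lg) gM.
Qed.

Lemma max_cones_le f l y : 0 <= f y ->
  (forall j, j \in l -> rational_cone j y <= f y) -> max_cones l y <= f y.
Proof.
move=> f0; elim: l => //= j l IH h; rewrite ge_max h ?mem_head// IH// => j' jl.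
by apply: h; rewrite in_cons jl orbT.
Qed.

Lemma max_cones_ge l j y : j \in l -> rational_cone j y <= max_cones l y.
Proof.
elim: l => //= j' l IH; rewrite in_cons le_max => /orP[/eqP ->|/IH ->].
  by rewrite lexx.
by rewrite orbT.
Qed.

Lemma max_cones_ge0 l y : 0 <= max_cones l y.
Proof. by elim: l => //= j l IH; rewrite le_max IH orbT. Qed.

Lemma test_liminf_ge0 f M (e : R) : rho_continuous_real rho f -> (forall y, 0 <= f y <= M) ->
  0 < e -> exists N, forall n, (N <= n)%N -> \int[mu]_y f y - e < avg n f w.
Proof.
move=> cf fM e0.
have f0 y : 0 <= f y by have /andP[] := fM y.
have fM' y : `|f y| <= M by rewrite ger0_norm//; have /andP[] := fM y.
have bf := continuous_bmeas cf fM'.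
(* The codes below [n] whose cones lie under [f]. The maxima of these cones converge to [f], so one
   single test function nearly has the integral of [f]. *)
pose l n := [seq j <- iota 0 n | `[< forall y, rational_cone j y <= f y >]].
have lf n y : test_function (pickle (l n)) y <= f y.
  rewrite /test_function pickleK; apply: max_cones_le => // j.
  by rewrite mem_filter => /andP[/asboolP].
have t0 n y : 0 <= test_function n y by exact: max_cones_ge0.
have : (\int[mu]_y test_function (pickle (l n)) y) @[n --> \oo] --> \int[mu]_y f y.
  apply: (@Rint_cvg _ _ _ _ _ _ M) => // [n y|y].
    by rewrite ger0_norm//; apply: le_trans (lf n y) _; have /andP[] := fM y.
  apply/cvgnP => r r0; have [j jf jy] := rational_cone_approx y cf f0 r0.
  exists j.+1 => n jn; rewrite distrC ger0_norm ?subr_ge0 ?lf//.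
  have : rational_cone j y <= test_function (pickle (l n)) y.
    rewrite /test_function pickleK; apply: max_cones_ge.
    by rewrite mem_filter mem_iota add0n jn leq0n !andbT; apply/asboolP.
  by lra.
have e20 : 0 < e / 2 by rewrite divr_gt0.
move=> /cvgnP/(_ _ e20)[n /(_ n (leqnn n)) h1].
have /cvgnP/(_ _ e20)[N hN] := @tw (pickle (l n)); exists N => k /hN h2.
have h3 : avg k (test_function (pickle (l n))) w <= avg k f w by exact: le_bavg.
by move: h1 h2; rewrite !ltr_norml => /andP[? ?] /andP[? ?]; lra.
Qed.

Lemma test_liminf f M (e : R) : rho_continuous_real rho f -> (forall y, `|f y| <= M) ->
  0 < e -> exists N, forall n, (N <= n)%N -> \int[mu]_y f y - e < avg n f w.
Proof.
move=> cf fM e0; have bf := continuous_bmeas cf fM.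
have cfM : rho_continuous_real rho (fun y => f y + M).
  move=> x r /(cf x)[d d0 fd]; exists d => // y /fd.
  by rewrite opprD addrACA subrr addr0.
have [|N hN] := @test_liminf_ge0 (fun y => f y + M) (M + M) e cfM _ e0.
  by move=> y; have := fM y; rewrite ler_norml => /andP[? ?]; apply/andP; split; lra.
exists N.+1 => -[//|n] Nn; have := hN n.+1 (ltnW Nn).
rewrite bavgD bavg_cst RintD//; last exact: bmeas_cst.
by rewrite Rint_cst; lra.
Qed.

Lemma test_generic : generic rho T mu w.
Proof.
move=> f cf [M fM]; have bf := continuous_bmeas cf fM.
rewrite (EFin_Rintegral mu bf); apply: cvg_EFin; first exact: nearW.
apply/cvgnP => e e0.
have [N1 h1] := test_liminf cf fM e0.
have cNf : rho_continuous_real rho (fun y => - f y).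
  move=> x r /(cf x)[d d0 fd]; exists d => // y /fd.
  by rewrite -opprD normrN.
have [|N2 h2] := @test_liminf (fun y => - f y) M e cNf _ e0.
  by move=> y; rewrite normrN.
exists (maxn N1 N2) => n; rewrite geq_max => /andP[/h1 g1 /h2 g2].
have aN : avg n (fun y => - f y) w = - avg n f w by rewrite /bavg /bsum sumrN mulrN.
have iN : \int[mu]_y (- f y) = - \int[mu]_y f y.
  rewrite -mulN1r -RintZ//; by apply: eq_Rintegral => y _; rewrite mulN1r.
rewrite aN iN in g2; rewrite /= -/(bsum _ _ _ _) -/(avg n f w) ltr_norml.
by apply/andP; split; lra.
Qed.

End Determining.
(** * Generic points *)

Section Construction.
Variables (R : realType) (X : pointedType) (rho : X -> X -> R) (T : X -> X).
Hypotheses (rhoM : is_metric rho) (rhoX : rho_complete rho) (rhoS : rho_separable rho).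
Hypothesis cT : rho_continuous rho T.
Variable K : set X.
Hypotheses (lK : linkable rho T K) (cK : K_closeable rho T K).
Variable mu : probability (Borel rho) R.
Hypothesis muT : invariant_prob rho T mu.

Notation S := (@bsum _ (Borel rho) R T).
Notation avg := (@bavg _ (Borel rho) R T).

Lemma iter_continuous j : rho_continuous rho (iter j T).
Proof.
elim: j => [|j IH] x e e0; first by exists e.
have [d d0 dT] := cT (iter j T x) e0; have [d' d'0 dj] := IH x d d0.
by exists d' => // y /dj /dT.
Qed.

Lemma generic_T x : generic rho T mu x -> generic rho T mu (T x).
Proof.
move=> gx f cf [M fM]; have bf := continuous_bmeas cf fM.
rewrite (EFin_Rintegral mu bf); apply: cvg_EFin; first exact: nearW.
apply/cvgnP => e e0; have e20 : 0 < e / 2 by rewrite divr_gt0.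
have /cvgnP/(_ _ e20)[N1 h1] := generic_cvg gx cf fM.
have [N2 h2] := @bavg_shift _ (Borel rho) R T f x M fM _ e20.
exists (maxn N1 N2) => n; rewrite geq_max => /andP[/h1 g1 /h2 g2].
rewrite /= -/(bsum _ _ _ _) -/(avg n f (T x)).
have -> : avg n f (T x) - \int[mu]_y f y =
  (avg n f (T x) - avg n f x) + (avg n f x - \int[mu]_y f y) by ring.
by apply: le_lt_trans (ler_normD _ _) _; lra.
Qed.

Lemma generic_iter s x : generic rho T mu x -> generic rho T mu (iter s T x).
Proof. by move=> gx; elim: s => //= s; exact: generic_T. Qed.

Variable g : nat -> X -> R.
Hypothesis lg : forall n, bounded_lipschitz rho (g n).
Let m n := \int[mu]_y g n y.

Let bg n : @bmeas _ (Borel rho) R (g n).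
Proof.
have [L [M [L0 Lg gM]]] := lg n.
exact: continuous_bmeas (lipschitz_continuous_real rhoM Lg) gM.
Qed.

(** Linking needs one pair of constants. The whole sequence [g] need not have one, so stage [k]
    controls only its first [k] functions. *)
Lemma common_bounds k : exists L M, [/\ 0 <= L, 0 <= M,
  forall i, (i < k)%N -> lipschitz_real rho L (g i),
  forall i y, (i < k)%N -> `|g i y| <= M & forall i, (i < k)%N -> `|m i| <= M].
Proof.
elim: k => [|k [L [M [L0 M0 Lg gM mM]]]]; first by exists 0, 0.
have [L' [M' [L'0 Lg' gM']]] := lg k.
have M'0 : 0 <= M' by exact: le_trans (gM' point).
exists (L + L'), (M + M'); split; rewrite ?addr_ge0//.
- move=> i; rewrite ltnS leq_eqVlt => /orP[/eqP ->|ik] x y; rewrite mulrDl.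
    by apply: le_trans (Lg' x y) _; rewrite lerDr mulr_ge0// rho_ge0.
  by apply: le_trans (Lg i ik x y) _; rewrite lerDl mulr_ge0// rho_ge0.
- move=> i y; rewrite ltnS leq_eqVlt => /orP[/eqP ->|ik].
    by apply: le_trans (gM' y) _; rewrite lerDr.
  by apply: le_trans (gM i y ik) _; rewrite lerDl.
- move=> i; rewrite ltnS leq_eqVlt => /orP[/eqP ->|ik].
    apply: (@le_trans _ _ M'); last by rewrite lerDr.
    rewrite -[m k]subr0 -(Rint_cst mu 0); apply: Rint_dist => //; first exact: bmeas_cst.
    by move=> y; rewrite subr0.
  by apply: le_trans (mM i ik) _; rewrite lerDl.
Qed.

Variable c : R.
Hypothesis c0 : 0 < c.
Let eta j : R := c / (2 ^ j)%:R.

Let eta0 j : 0 < eta j.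
Proof. by rewrite /eta divr_gt0// ltr0n expn_gt0. Qed.

Let etaS j : eta j = 2 * eta j.+1.
Proof.
have : (2 ^ j)%:R != 0 :> R by rewrite pnatr_eq0 expn_eq0.
by rewrite /eta expnS natrM; move: (2 ^ j)%:R => t t0; field.
Qed.

Lemma target_orbit j : exists zr : X * nat, [/\ K zr.1, iter zr.2 T zr.1 = zr.1,
  (0 < zr.2)%N & forall i, (i < j)%N ->
    `|S zr.2 (g i) zr.1 - zr.2%:R * m i| <= eta j * zr.2%:R].
Proof.
have [L [M [L0 M0 Lg gM mM]]] := common_bounds j.
have [z [r [Kz zr r0 h]]] :=
  K_periodic_dense rhoM rhoX rhoS cT lK cK L0 Lg gM M0 muT (eta0 j).
exists (z, r); split=> //= i ij; have rR0 : 0 < r%:R :> R by rewrite ltr0n.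
have -> : S r (g i) z - r%:R * m i = (avg r (g i) z - m i) * r%:R.
  by rewrite /bavg mulrBl mulrAC mulVf ?mul1r ?gt_eqF// mulrC.
by rewrite normrM (gtr0_norm rR0) ler_pM2r//; exact: h.
Qed.

(* A stage consists of a point of [K], a period, and the length of the shadowing of the
   previous stage. *)
Let stage := ((X * nat) * nat)%type.
Let valid (st : stage) :=
  [/\ K st.1.1, iter st.1.2 T st.1.1 = st.1.1 & (0 < st.1.2)%N].

Let linked j (st st' : stage) :=
  [/\ valid st', (st.2 < st'.2)%N, bowen_ball rho T st.1.1 st'.2 (eta j) st'.1.1 &
    forall i, (i < j)%N ->
      `|S st'.1.2 (g i) st'.1.1 - st'.1.2%:R * m i| <= 2 * eta j * st'.1.2%:R /\
      forall d, eta j <= d -> `|S st.1.2 (g i) st.1.1 - st.1.2%:R * m i| <= d * st.1.2%:R ->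
        forall n, (st'.2 <= n)%N ->
          `|S n (g i) st'.1.1 - n%:R * m i| <= (d + eta j) * n%:R].

Lemma next_stage j st : valid st -> exists st', linked j st st'.
Proof.
move=> [Kw wq q0]; have [L [M [L0 M0 Lg gM mM]]] := common_bounds j.
have [[z r] [Kz zr r0 hz]] := target_orbit j.
have [w' [q' [P [v' NP sh h]]]] :=
  link_step lK L0 Lg gM M0 st.2.+1 mM Kw wq q0 Kz zr r0 (eta0 j) hz.
by exists ((w', q'), P).
Qed.

Variables (w0 : X) (q0 s : nat).
Hypothesis valid0 : valid ((w0, q0), s).

Lemma stages : exists st : nat -> stage,
  st 0%N = ((w0, q0), s) /\ forall j, linked j (st j) (st j.+1).
Proof.
have nx (x : nat * stage) : exists st', valid x.2 -> linked x.1 x.2 st'.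
  have [v|nv] := pselect (valid x.2); last by exists x.2.
  by have [st' h] := next_stage x.1 v; exists st'.
have [F FP] := choice nx.
pose st := fix st n := if n is n'.+1 then F (n', st n') else ((w0, q0), s).
have v n : valid (st n).
  by elim: n => // n IH; have [] := FP (n, st n) IH.
by exists st; split=> // j; exact: (FP (j, st j) (v j)).
Qed.

(** At times from [P j.+2] to [P j.+3] the limit point shadows [W j.+2], whose averages there are
    controlled through the deviation [2 * eta j] of the whole period of [W j.+1]. These windows
    cover all large times. *)
Lemma generic_shadow : exists2 w, (forall n, (avg N (g n) w) @[N --> \oo] --> m n) &
  rho (iter s T w) (iter s T w0) < 3 * c.
Proof.
have [st [st0 stP]] := stages.
pose W j := (st j).1.1; pose Q j := (st j).1.2; pose P j := (st j).2.
have PS j : (P j < P j.+1)%N by case: (stP j).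
have Pmono i j : (i <= j)%N -> (P i <= P j)%N.
  by move/subnK <-; elim: (j - i)%N => // k /leq_trans; apply; exact: ltnW.
have Pge j : (j <= P j)%N by elim: j => // j IH; exact: leq_ltn_trans (PS j).
have sh j t : (t < P j.+1)%N -> rho (iter t T (W j.+1)) (iter t T (W j)) < eta j.
  by have [_ _ + _] := stP j; exact.
(* Telescoping: the next stage adds at most [eta (j + l)], which equals
   [2 * eta (j + l) - 2 * eta (j + l).+1]. *)
have shl j l t : (t < P j.+1)%N ->
    rho (iter t T (W (j + l)%N)) (iter t T (W j)) <= 2 * eta j - 2 * eta (j + l)%N.
  move=> tP; elim: l => [|l IH]; first by rewrite addn0 (rhoxx rhoM) subrr.
  rewrite addnS.
  have tP' : (t < P (j + l).+1)%N by apply: leq_trans tP (Pmono _ _ _); rewrite ltnS leq_addr.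
  have := rho_triangle rhoM (iter t T (W (j + l).+1)) (iter t T (W (j + l)%N)) (iter t T (W j)).
  by have := sh _ _ tP'; have := etaS (j + l); lra.
have shn j n t : (t < P j.+1)%N -> (j <= n)%N ->
    rho (iter t T (W n)) (iter t T (W j)) <= 2 * eta j.
  move=> tP jn; have := shl j (n - j)%N t tP; rewrite subnKC//.
  by have := eta0 n; lra.
have etalim e : 0 < e -> exists j, eta j < e.
  move=> e0; exists (Num.bound (c / e)).
  have h := archi_boundP (ltW (divr_gt0 c0 e0)).
  rewrite /eta ltr_pdivrMr ?ltr0n ?expn_gt0// mulrC -ltr_pdivrMr//.
  apply: lt_le_trans h _; rewrite ler_nat; exact/ltnW/ltn_expl.
have [w wl] : exists w, forall e : R, 0 < e ->
    exists N, forall n, (N <= n)%N -> rho (W n) w < e.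
  apply: rhoX => e e0; have [j hj] := etalim (e / 4) (divr_gt0 e0 (ltr0Sn R 3)).
  exists j => a b ja jb.
  have tP : (0 < P j.+1)%N by apply: leq_trans (Pge _).
  have h1 := shn j a 0%N tP ja; have h2 := shn j b 0%N tP jb.
  have := rho_triangle rhoM (W a) (W j) (W b); rewrite (rhoC rhoM (W j)) /= in h1 h2 *.
  by lra.
(* [2 * eta j] for all later stages and [eta j] for the passage to the limit at the single time
   [t]. *)
have shw j : bowen_ball rho T (W j) (P j.+1) (3 * eta j) w.
  move=> t tP; have [d d0 dT] := iter_continuous t w (eta0 j).
  have [N hN] := wl d d0.
  have h1 : rho (iter t T w) (iter t T (W (maxn N j))) < eta j.
    by apply: dT; rewrite (rhoC rhoM); apply: hN; exact: leq_maxl.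
  have h2 := shn j _ t tP (leq_maxr N j).
  by have := rho_triangle rhoM (iter t T w) (iter t T (W (maxn N j))) (iter t T (W j)); lra.
exists w; last first.
  (* Stage 0 carries [s] as its length, so the first shadowing includes time [s]. *)
  have := shw 0%N s; rewrite /W st0 /eta expn0 divr1; apply.
  by have := PS 0%N; rewrite /P st0.
move=> i; have [L [M [L0 Lg gM]]] := lg i.
have bound j n : (i < j)%N -> (P j.+2 <= n)%N -> (n <= P j.+3)%N ->
    `|S n (g i) w - n%:R * m i| <= (3 + 3 * L) * eta j * n%:R.
  move=> ij Pn nP.
  have [_ _ _ /(_ i ij)[a _]] := stP j.
  have [_ _ _ /(_ i (ltnW ij))[_ b]] := stP j.+1.
  have h1 := b (2 * eta j) _ a n Pn.
  have {}h1 : `|S n (g i) (W j.+2) - n%:R * m i| <= (2 * eta j + eta j.+1) * n%:R.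
    by apply: h1; have := etaS j; have := eta0 j.+1; lra.
  have h2 := bsum_shadow L0 Lg nP (shw j.+2).
  have -> : S n (g i) w - n%:R * m i =
    (S n (g i) w - S n (g i) (W j.+2)) + (S n (g i) (W j.+2) - n%:R * m i) by ring.
  apply: le_trans (ler_normD _ _) _; apply: le_trans (lerD h2 h1) _.
  rewrite -mulrDl ler_wpM2r//.
  have e1 := etaS j; have e2 := etaS j.+1; have e3 := eta0 j.+2.
  have := mulr_ge0 L0 (ltW e3); nra.
apply/cvgnP => e e0.
have C0 : 0 < 3 + 3 * L by lra.
have [j1 hj1] := etalim (e / (3 + 3 * L)) (divr_gt0 e0 C0).
pose j0 := maxn j1 i.+1; exists (P j0.+2) => n Pn.
have etad a b : (a <= b)%N -> eta b <= eta a.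
  move/subnK <-; elim: (b - a)%N => // k IH; apply: le_trans IH.
  by rewrite addSn (etaS (k + a)); have := eta0 (k + a).+1; lra.
have [j [jj Pj nP]] : exists j, [/\ (j0 <= j)%N, (P j.+2 <= n)%N & (n <= P j.+3)%N].
  apply: contrapT => /forallNP H.
  have H' l : (P (j0 + l).+2 <= n)%N.
    elim: l => [|l IH]; first by rewrite addn0.
    rewrite addnS ltnW// ltnNge; apply/negP => h; apply: (H (j0 + l)%N).
    by split=> //; exact: leq_addr.
  by have := leq_trans (Pge _) (H' n); rewrite ltnNge leqW// leq_addl.
have ij : (i < j)%N by apply: leq_trans jj; exact: leq_maxr.
have nR0 : 0 < n%:R :> R.
  rewrite ltr0n; apply: leq_trans (leq_trans (Pge _) Pj); by [].
have h := bound j n ij Pj nP.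
have -> : avg n (g i) w - m i = n%:R^-1 * (S n (g i) w - n%:R * m i).
  by rewrite mulrBr mulKf// gt_eqF.
rewrite normrM gtr0_norm ?invr_gt0// ltr_pdivrMl// [X in _ < X]mulrC.
apply: le_lt_trans h _; rewrite ltr_pM2r// mulrC -ltr_pdivlMr//.
by apply: le_lt_trans hj1; apply: etad; apply: leq_trans jj; exact: leq_maxl.
Qed.

End Construction.

(** * Periodic orbits near the measure center *)

Section MeasureCenter.
Variables (R : realType) (X : pointedType) (rho : X -> X -> R) (T : X -> X).
Hypotheses (rhoM : is_metric rho) (rhoX : rho_complete rho) (rhoS : rho_separable rho).
Hypothesis cT : rho_continuous rho T.
Variable K : set X.
Hypothesis cK : K_closeable rho T K.

(** The measure that charges the ball is only invariant, whereas closeability needs an ergodic one.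
    A continuous bump, positive exactly on the ball, carries the charge over by
    [bounded_ergodic_ge], and its averages force a generic point to enter the ball. *)
Lemma K_visits_center x (e : R) : measure_center rho T x -> 0 < e ->
  exists y q s, [/\ K y, iter q T y = y, (0 < q)%N & rho x (iter s T y) < e].
Proof.
move=> Cx e0; pose U := [set y | rho x y < e].
have [nu nuT nuU] : exists2 nu : probability (Borel rho) R,
    invariant_prob rho T nu & nu U <> 0%E.
  apply: contrapT => /forall2NP H; apply: Cx; exists U; split.
  - exact: rho_open_ball.
  - by move=> nu nuT; have [//|/contrapT] := H nu.
  - by rewrite /U /= (rhoxx rhoM).
pose phi y := cone rho x e 1 y.
have [L [M [L0 Lphi phiM]]] : bounded_lipschitz rho phi.
  exact: (bounded_lipschitz_cone rhoM x (ltW e0) ler01).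
have cphi := lipschitz_continuous_real rhoM Lphi; have bphi := continuous_bmeas cphi phiM.
have phi0 y : 0 <= phi y by rewrite /phi /cone le_max lexx.
have phiU y : 0 < phi y <-> U y.
  by rewrite /phi /cone lt_max ltxx /= mul1r subr_gt0.
have ip : 0 < \int[nu]_y phi y.
  rewrite lt_neqAle (_ : 0 <= _); last exact: Rintegral_ge0.
  rewrite andbT eq_sym; apply/eqP => i0; apply: nuU.
  have [N [mN PN hN]] := ae_eq0_Rint bphi phi0 i0.
  have mU : measurable (U : set (Borel rho)) by apply: measurable_open; exact: rho_open_ball.
  apply/eqP; rewrite eq_le measure_ge0 andbT -PN; apply: le_measure; rewrite ?inE//.
  by move=> y /phiU h; apply: hN => /= h0; rewrite h0 ltxx in h.
have ip2 : 0 < \int[nu]_y phi y / 2 by rewrite divr_gt0.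
have [nu' erg hnu'] := bounded_ergodic_ge rhoM rhoX rhoS cT nuT bphi ip2.
have [x0 [gx0 cx0]] := cK erg.
have ip' : 0 < \int[nu']_y phi y by lra.
have /cvgnP/(_ _ ip')[N /(_ N (leqnn N)) hN] := generic_cvg gx0 cphi phiM.
have [s hs] : exists s, 0 < phi (iter s T x0).
  apply: contrapT => /forallNP H; move: hN.
  have -> : bavg (T : Borel rho -> Borel rho) N phi x0 = 0.
    rewrite /bavg /bsum big1 ?mulr0// => j _; apply/eqP.
    by rewrite eq_le phi0 andbT leNgt; apply/negP/H.
  by rewrite sub0r normrN gtr0_norm// ltxx.
have xs : rho x (iter s T x0) < e by exact/phiU.
(* The room left in the ball at time [s] is the tolerance for closing, and the length [s.+1] makes
   the shadowing include time [s]. *)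
have gap : 0 < e - rho x (iter s T x0) by rewrite subr_gt0.
have [p [q [Np pq _ [y [xy Ky yq]]]]] := cx0 _ s.+1 gap (ltn0Sn s).
exists y, q, s; split=> //; first by apply: leq_trans pq; exact: leq_trans Np.
have := xy s Np; have := rho_triangle rhoM x (iter s T x0) (iter s T y).
by rewrite (rhoC rhoM (iter s T x0) (iter s T y)); lra.
Qed.

End MeasureCenter.

Theorem theorem6p2 (R : realType) (X : pointedType) (rho : X -> X -> R) (T : X -> X)
  (K : set X) :
  is_metric rho -> rho_complete rho -> rho_separable rho ->
  rho_continuous rho T -> (forall y : X, exists x : X, T x = y) ->
  linkable rho T K -> K_closeable rho T K ->
  forall mu : probability (Borel rho) R, invariant_prob rho T mu ->
  forall x : X, measure_center rho T x ->
  forall e : R, 0 < e -> exists2 y : X, generic rho T mu y & rho x y < e.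
Proof.
move=> rhoM rhoX rhoS cT _ lK cK mu muT x Cx e e0.
have e20 : 0 < e / 2 by rewrite divr_gt0.
(* [generic_shadow] with [c = e / 6] moves the point by less than [3 * c = e / 2]. *)
have e60 : 0 < e / 6 by rewrite divr_gt0.
have [w0 [q [s [Kw0 w0q q0 xs]]]] := K_visits_center rhoM rhoX rhoS cT cK Cx e20.
have [D dD] := dense_sequence rhoM rhoS.
have [w tw ws] := generic_shadow rhoM rhoX rhoS cT lK cK muT
  (bounded_lipschitz_test rhoM D) e60 (w0 := w0) (q0 := q) (s := s) (And3 Kw0 w0q q0).
exists (iter s T w); first by apply: generic_iter; exact: test_generic tw.
have := rho_triangle rhoM x (iter s T w0) (iter s T w).
by rewrite (rhoC rhoM (iter s T w0) (iter s T w)); lra.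
Qed.
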